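(* Let $d,\tilde\zeta>0$ and let $\tilde f\in\mathbb{R}$ satisfy $0<|\tilde f|<\frac{2\sqrt3}{9}\tilde\zeta^{3/2}$. Then for all sufficiently small $\varepsilon,\kappa>0$ there are two even homoclinic solutions $a_{\varepsilon,\kappa}$ of $$-da''-(\mathrm{i}-\zeta)a-(1+\mathrm{i}\kappa)|a|^2a+\mathrm{i}f=0\quad\text{on }\mathbb{R},\qquad a'(0)=0,$$ with $\zeta=\tilde\zeta\varepsilon^{-1}$, $f=\tilde f\varepsilon^{-3/2}$, satisfying $$\Bigl\|a_{\varepsilon,\kappa}-\lim_{|x|\to\infty}a_{\varepsilon,\kappa}(x)\Bigr\|_{H^2}\to\infty\quad\text{as }\varepsilon\to0$$ uniformly with respect to $\kappa$.
   Context: An even homoclinic solution is an even complex-valued solution of the form $a=\tilde a+a^\infty$ with a constant $a^\infty\in\mathbb{C}$ and $\tilde a\in H^2(\mathbb{R};\mathbb{C})$, so that $a^\infty=\lim_{|x|\to\infty}a(x)$. ''For all sufficiently small $\varepsilon,\kappa>0$'' means: there are $\varepsilon_0,\kappa_0>0$ depending on $d,\tilde\zeta,\tilde f$ such that the assertion holds for all $0<\varepsilon<\varepsilon_0$ and $0<\kappa<\kappa_0$. The norm is that of $H^2(\mathbb{R};\mathbb{C})$, and the limit statement holds for each of the two families of solutions. *)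

(* Defs.v *)
(* Everything is over an abstract [R : realType]; the field of complex numbers
   is [R[i]] from mathcomp-real-closed. *)
From HB Require Import structures.
From mathcomp Require Export all_boot all_order all_algebra.
From mathcomp Require Export complex.
From mathcomp Require Export all_classical all_reals all_analysis.

Set Implicit Arguments.
Unset Strict Implicit.
Unset Printing Implicit Defensive.

Import Order.TTheory GRing.Theory Num.Theory.
Export numFieldNormedType.Exports.

Local Open Scope classical_set_scope.
Local Open Scope ring_scope.
Local Open Scope complex_scope.

Section Defs.
Context {R : realType}.
Local Notation C := R[i].
Local Notation mu := (@lebesgue_measure R).
Implicit Types (a u v w : R -> C) (phi : R -> R).

Definition re u : R -> R := fun x => complex.Re (u x).
Definition im u : R -> R := fun x => complex.Im (u x).

(* [R[i]] is not a normed module over [R] in the library, so differentiation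
   of [C]-valued functions of a real variable is componentwise. *)
Definition cderivable u (x : R) : Prop :=
  derivable (re u) x 1 /\ derivable (im u) x 1.
Definition cderive u : R -> C := fun x => derive1 (re u) x +i* derive1 (im u) x.

Definition L2 u : Prop := re u \in Lfun mu 2%:E /\ im u \in Lfun mu 2%:E.
Definition L2norm u : R :=
  fine ('N[mu]_2%:E [ (fun x => (ComplexField.Normc.normc (u x))%:E) ])%E.

Definition test_function phi : Prop :=
  (forall (n : nat) (x : R), derivable (derive1n n phi) x 1) /\
  compact (closure [set x | phi x != 0]).

(* Real-valued test functions suffice: the identity for complex-valued ones
   follows by linearity. *)
Definition weak_derivative u v : Prop :=
  forall phi, test_function phi ->
    (\int[mu]_x (re u x * derive1 phi x) = - (\int[mu]_x (re v x * phi x)))%R /\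
    (\int[mu]_x (im u x * derive1 phi x) = - (\int[mu]_x (im v x * phi x)))%R.

(* The Sobolev space H^2(R; C), on representatives. *)
Definition H2 u : Prop :=
  L2 u /\ exists v w,
    [/\ weak_derivative u v, L2 v, weak_derivative v w & L2 w].

(* A representative of the weak derivative, which is unique up to a null set
   when it exists; the norm below does not depend on the representative. *)
Definition wderive u : R -> C :=
  xget (fun=> 0) [set v | weak_derivative u v /\ L2 v].

Definition H2norm u : R :=
  Num.sqrt (L2norm u ^+ 2 + L2norm (wderive u) ^+ 2
            + L2norm (wderive (wderive u)) ^+ 2).

(* Classical solutions. An [H^2]-solution plus a constant has a continuous
   second derivative by the equation, so nothing is lost; this also fixes the
   representative for which a'(0) is meaningful. *)
Definition is_solution (d zeta f kappa : R) a : Prop :=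
  forall x : R,
    [/\ cderivable a x, cderivable (cderive a) x &
     - d%:C * cderive (cderive a) x - ('i%C - zeta%:C) * a x
     - (1 + 'i%C * kappa%:C) * `|a x| ^+ 2 * a x + 'i%C * f%:C = 0].

(* [ainf] is the constant a^oo in the decomposition of a. *)
Definition even_homoclinic_solution (d zeta f kappa : R) a (ainf : C) : Prop :=
  [/\ is_solution d zeta f kappa a, cderive a 0 = 0,
      (forall x : R, a (- x) = a x) & H2 (fun x => a x - ainf)].

(* [C^o] carries the norm topology of the numeric field [C]. *)
Definition limit_at_infinity a (l : C) : Prop :=
  (a x : C^o) @[x --> +oo] --> (l : C^o) /\
  (a x : C^o) @[x --> -oo] --> (l : C^o).

End Defs.

(* Main.v *)
Require Import Defs.
From mathcomp Require Import all_boot all_order all_algebra.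
From mathcomp Require Import complex ring lra.
From mathcomp Require Import all_classical all_reals all_analysis measurable_realfun.
Import Order.TTheory GRing.Theory Num.Theory.
Import numFieldNormedType.Exports.
Local Open Scope classical_set_scope.
Local Open Scope ring_scope.
Set Implicit Arguments.
Unset Strict Implicit.
Unset Printing Implicit Defensive.

(** The scaling [a (x) = i eps^(-1/2) U (eps^(-1/2) x)] turns the equation into
    [- d U'' + zt U - i eps U - (1 + i kappa) |U|^2 U + ft = 0], where [eps] and
    [kappa] are regular perturbation parameters.  At [eps = kappa = 0] it has
    real solutions [U = c + w]: [c] is the root of [zt c - c^3 + ft] between the
    critical points of this cubic, and [w] is one of two explicit functions, of
    opposite signs, homoclinic to zero ([homoclinic_profile]).  If [c + w] persists
    for small [eps] and [kappa], undoing the scaling multiplies amplitudes by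
    [eps^(-1/2)] and lengths by [eps^(1/2)]; the square of the [L^2]-norm is then
    at least of order [eps^(-1/2)], whatever [kappa] is ([solution_family]), and
    the opposite signs keep the two families apart.

    Persistence is a contraction argument, first for the constant state
    ([equilibrium]), then for the profile ([perturbation]), in spaces of functions
    weighted by an exponential.  It needs the linearization at [c + w] to be
    invertible on even functions.  On [U = c + w + p + i q] the linearization
    splits into [- d p'' + (zt - 3 (c + w)^2) p] and [- d q'' + (zt - (c + w)^2) q].
    Up to the factor [d], each is [- y'' + (l^2 + V) y] with [V] decaying
    exponentially, and Volterra equations provide a solution that decays like
    [exp (- l x)] ([jost_solution]) and one with zero slope at the origin that
    grows at most like [exp (l x)] ([regular_solution]).  They give a Green's
    operator preserving exponential decay ([green_operator]), provided that the
    decaying solution has nonzero slope at the origin.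

    For the first block, [w'] is a decaying solution that vanishes at the origin;
    so every decaying solution vanishes there, and its slope is then nonzero
    ([slope_neq0_tangential]).  For the second block, Sturm comparison with [|w'|] shows that the decaying solution is
    positive ([decaying_gt0]).  Since [c + w] is mapped to the constant [- ft] by
    this block, Green's identity expresses the slope as [ft] times the integral of
    that positive function ([slope_neq0_transversal]): this uses [ft != 0].

    Even functions are handled through their restriction to [[0, +oo[], with
    two-sided derivatives at every point of it, and estimates are only made there;
    a zero slope at the origin makes the even extension smooth again. *)

Local Notation der f x a :=
  (is_derive (x : _) (1 : _) (f : _ -> _) a) (only parsing).

(** * Derivatives of functions on a half-line *)

Section Derivatives.
Context {R : realType}.
Implicit Types (f g : R -> R) (x a b c : R).

Lemma is_derive_val f x a b : a = b -> der f x a -> der f x b.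
Proof. by move=> ->. Qed.

Lemma is_derive_addf f g x a b : der f x a -> der g x b ->
  der (fun y => f y + g y) x (a + b).
Proof. by move=> df dg; apply: is_deriveD. Qed.

Lemma is_derive_oppf f x a : der f x a -> der (fun y => - f y) x (- a).
Proof. by move=> df; apply: is_deriveN. Qed.

Lemma is_derive_mulf f g x a b : der f x a -> der g x b ->
  der (fun y => f y * g y) x (a * g x + f x * b).
Proof.
move=> df dg; have h : der (f * g) x (f x *: b + g x *: a) by exact: is_deriveM.
by apply: is_derive_val h; rewrite /GRing.scale /=; ring.
Qed.

Lemma is_derive_cstf c x : der (fun=> c) x 0.
Proof. exact: is_derive_cst. Qed.

Lemma is_derive_cmulf c f x a : der f x a -> der (fun y => c * f y) x (c * a).
Proof.
move=> df; apply: is_derive_val (is_derive_mulf (is_derive_cstf c x) df).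
by rewrite mul0r add0r.
Qed.

Lemma is_derive_idf x : der (fun y => y) x 1.
Proof. exact: is_derive_id. Qed.

Lemma is_derive_compf f g x a b : der f (g x) a -> der g x b ->
  der (fun y => f (g y)) x (a * b).
Proof. by move=> df dg; apply: is_derive1_comp. Qed.

Lemma is_derive_expf f x a : der f x a ->
  der (fun y => expR (f y)) x (expR (f x) * a).
Proof. by move=> df; apply: is_derive_compf. Qed.

Lemma is_derive_expl l x : der (fun y => expR (l * y)) x (l * expR (l * x)).
Proof.
apply: is_derive_val (is_derive_expf (is_derive_cmulf l (is_derive_idf x))).
by rewrite mulr1 mulrC.
Qed.

Lemma is_derive_invf f x a : f x != 0 -> der f x a ->
  der (fun y => (f y)^-1) x (- a / f x ^+ 2).
Proof.
move=> fx0 df; apply: is_derive_val (is_deriveV fx0 df).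
by rewrite /GRing.scale /= -exprVn; ring.
Qed.

Lemma is_derive_ext f g x a : (forall y, f y = g y) -> der f x a -> der g x a.
Proof. by move=> /funext ->. Qed.

Lemma is_derive_cont f x a : der f x a -> {for x, continuous f}.
Proof. by move=> [/derivable1_diffP/differentiable_continuous]. Qed.

Lemma is_derive_derive1 f x a : der f x a -> derivable f x 1 /\ derive1 f x = a.
Proof. by move=> [df <-]; rewrite derive1E. Qed.

Lemma within_cont f a b : (forall x, a <= x -> {for x, continuous f}) ->
  {within `[a, b], continuous f}.
Proof.
move=> cf; apply: continuous_in_subspaceT => x.
by rewrite inE /= in_itv /= => /andP[ax _]; apply: cf.
Qed.

Lemma mean_value f f' (a x y : R) : (forall x, a <= x -> der f x (f' x)) ->
  a <= x -> x < y -> exists c, [/\ x < c, c < y & f y - f x = f' c * (y - x)].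
Proof.
move=> df ax xy; have [z||c] := @MVT _ f f' _ _ xy.
- by rewrite in_itv /= => /andP[xz _]; apply: df; apply: le_trans ax (ltW xz).
- by apply: within_cont => z xz; apply: is_derive_cont (df z (le_trans ax xz)).
by rewrite in_itv /= => /andP[xc cy] E; exists c.
Qed.

Lemma ge0_derive_le f f' (a x y : R) :
  (forall x, a <= x -> der f x (f' x)) -> (forall x, a <= x -> 0 <= f' x) ->
  a <= x -> x <= y -> f x <= f y.
Proof.
move=> df f'0 ax; rewrite le_eqVlt => /orP[/eqP->//|xy].
have [c [xc cy E]] := mean_value df ax xy.
by rewrite -subr_ge0 E mulr_ge0 ?f'0 ?subr_ge0 ?(ltW xy)// (le_trans ax (ltW xc)).
Qed.

Lemma derive0_cst f (a x : R) : (forall x, a <= x -> der f x 0) ->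
  a <= x -> f x = f a.
Proof.
move=> df ax; apply/eqP; rewrite eq_le; apply/andP; split; last first.
  exact: (@ge0_derive_le f (fun=> 0) a).
rewrite -lerN2; apply: (@ge0_derive_le (fun y => - f y) (fun=> 0) a) => // y ay.
by apply: is_derive_val (is_derive_oppf (df y ay)); rewrite oppr0.
Qed.

(** On [[x, x + 1]] the mean slope is small and the slope varies little.  Only the
    values and the second derivatives of solutions are estimated in the sequel;
    this bounds the slopes. *)
Lemma derive_decay (f f' f'' : R -> R) (g K K2 : R) : 0 < g ->
  (forall x, 0 <= x -> der f x (f' x)) ->
  (forall x, 0 <= x -> der f' x (f'' x)) ->
  (forall x, 0 <= x -> `|f x| <= K * expR (- g * x)) ->
  (forall x, 0 <= x -> `|f'' x| <= K2 * expR (- g * x)) ->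
  forall x, 0 <= x -> `|f' x| <= (K + K + K2) * expR (- g * x).
Proof.
move=> g0 df df' fK f''K x x0.
have dec y : x <= y -> expR (- g * y) <= expR (- g * x).
  by move=> xy; rewrite ler_expR; nra.
have nn (z : R) B y : 0 <= B * expR (- g * y) -> 0 <= B.
  by rewrite pmulr_lge0 ?expR_gt0.
have K0 : 0 <= K by apply: (nn 0 _ x); apply: le_trans (fK x x0).
have K20 : 0 <= K2 by apply: (nn 0 _ x); apply: le_trans (f''K x x0).
have lt1 : x < x + 1 by lra.
have [c [xc cx E]] := mean_value df x0 lt1.
have c0 : 0 <= c by lra.
have [e [xe ec E2]] := mean_value df' x0 xc.
have -> : f' x = (f (x + 1) - f x) - f'' e * (c - x) by rewrite E -E2; ring.
have e0 : 0 <= e by lra.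
have x10 : 0 <= x + 1 by lra.
have A1 := le_trans (fK _ x10) (ler_wpM2l K0 (dec _ (ltW lt1))).
have A2 := fK _ x0.
have A3 := le_trans (f''K _ e0) (ler_wpM2l K20 (dec _ (ltW xe))).
have A4 : `|f'' e * (c - x)| <= K2 * expR (- g * x).
  rewrite normrM; apply: le_trans A3; rewrite ler_piMr ?normr_ge0//.
  by rewrite ger0_norm; lra.
apply: le_trans (ler_normB _ _) _; rewrite 2!mulrDl lerD//.
by apply: le_trans (ler_normB _ _) _; rewrite lerD.
Qed.

Lemma is_deriveP f x a : der f x a <-> forall e, 0 < e -> exists2 r, 0 < r &
  forall h, `|h| < r -> h != 0 -> `|a - h^-1 * (f (h + x) - f x)| <= e.
Proof.
have E : (fun h => h^-1 *: ((f \o shift x) (h *: (1 : R)) - f x)) =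
    (fun h => h^-1 * (f (h + x) - f x)).
  by apply/funext => h; rewrite /= /GRing.scale /= mulr1.
split=> [[dv dE] e e0|H].
  have : (fun h => h^-1 * (f (h + x) - f x)) @ (0 : R)^' --> (a : R^o).
    by rewrite -dE -E; exact: dv.
  move=> /cvgrPdist_le/(_ e e0)[r /= r0 Hr]; exists r => // h hr h0.
  by apply: Hr; rewrite /ball_ /= ?sub0r ?normrN.
have lim1 : (fun h => h^-1 *: ((f \o shift x) (h *: (1 : R)) - f x)) @ (0 : R)^'
    --> (a : R^o).
  rewrite E; apply/cvgrPdist_le => e /H[r r0 Hr]; exists r => // h; rewrite /ball_ /= ?sub0r.
  by rewrite normrN => /Hr; apply.
by split; [apply/cvg_ex; exists a | apply/cvg_lim].
Qed.

(** The difference quotient of the even extension at the origin is that of [f], up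
    to sign, and [f' 0 = 0]. *)
Lemma is_derive_even f (f' : R -> R) : (forall x, 0 <= x -> der f x (f' x)) ->
  f' 0 = 0 -> forall x, der (fun y => f `|y|) x (Num.sg x * f' `|x|).
Proof.
move=> df f'0 x; have [x0|x0|->] := ltgtP x 0.
- have := @is_derive_compf f (fun y => - y) x _ (- 1) (df (- x) _) _.
  rewrite oppr_ge0 => /(_ (ltW x0) (is_derive_oppf (is_derive_idf x))) h.
  rewrite ltr0_sg // ltr0_norm //.
  apply: (@near_eq_is_derive _ _ _ (fun y => f (- y))); last first.
    by apply: is_derive_val h; ring.
  by near=> y; rewrite ltr0_norm //; near: y; apply: lt_nbhsl.
- rewrite gtr0_sg // gtr0_norm // mul1r.
  apply: (@near_eq_is_derive _ _ _ f); last exact: df (ltW x0).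
  by near=> y; rewrite gtr0_norm //; near: y; apply: lt_nbhsr.
- rewrite sgr0 mul0r; apply/is_deriveP => e e0.
  have /is_deriveP/(_ e e0)[r r0 H] := df 0 (lexx 0); exists r => // h hr h0.
  have := H `|h|; rewrite f'0 !addr0 normr_id normr_eq0 normr0 !sub0r.
  by rewrite !normrN !normrM !normfV normr_id; apply.
Unshelve. all: by end_near. Qed.

Lemma is_derive_odd f (f' : R -> R) : (forall x, 0 <= x -> der f x (f' x)) ->
  f 0 = 0 -> forall x, der (fun y => Num.sg y * f `|y|) x (f' `|x|).
Proof.
move=> df f0 x; have [x0|x0|->] := ltgtP x 0.
- have := @is_derive_compf f (fun y => - y) x _ (- 1) (df (- x) _) _.
  rewrite oppr_ge0 => /(_ (ltW x0) (is_derive_oppf (is_derive_idf x))) h.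
  rewrite ltr0_norm //.
  apply: (@near_eq_is_derive _ _ _ (fun y => - f (- y))); last first.
    by apply: is_derive_val (is_derive_oppf h); ring.
  near=> y; have y0 : y < 0 by near: y; apply: lt_nbhsl.
  by rewrite ltr0_norm // ltr0_sg // mulN1r.
- rewrite gtr0_norm //.
  apply: (@near_eq_is_derive _ _ _ f); last exact: df (ltW x0).
  near=> y; have y0 : 0 < y by near: y; apply: lt_nbhsr.
  by rewrite gtr0_norm // gtr0_sg // mul1r.
- rewrite normr0; apply/is_deriveP => e e0.
  have /is_deriveP/(_ e e0)[r r0 H] := df 0 (lexx 0); exists r => // h hr h0.
  have := H `|h|; rewrite f0 !addr0 normr_id normr_eq0 sgr0 mul0r !subr0.
  suff -> : h^-1 * (Num.sg h * f `|h|) = `|h|^-1 * f `|h| by apply.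
  rewrite mulrA; congr (_ * _).
  by rewrite -normfV [RHS]normrEsg sgrV mulrC.
Unshelve. all: by end_near. Qed.

End Derivatives.

(** * Primitives from the origin and from infinity *)

Section Primitives.
Context {R : realType}.
Implicit Types (f g H : R -> R) (x y z e : R) (s : bool).
Local Notation mu := (@lebesgue_measure R).

Definition half_continuous f := forall x, 0 <= x -> {for x, continuous f}.

Lemma half_continuous_even f : half_continuous f -> continuous (fun x => f `|x|).
Proof.
move=> cf x; apply: (@continuous_comp _ _ _ (fun y : R => `|y|) f).
  exact: norm_continuous.
exact: cf.
Qed.

Lemma half_continuousM f g : half_continuous f -> half_continuous g ->
  half_continuous (fun x => f x * g x).
Proof. by move=> cf cg x x0; apply: cvgM; [exact: cf|exact: cg]. Qed.

Lemma half_continuousD f g : half_continuous f -> half_continuous g ->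
  half_continuous (fun x => f x + g x).
Proof. by move=> cf cg x x0; apply: cvgD; [exact: cf|exact: cg]. Qed.

Lemma half_continuousX f n : half_continuous f -> half_continuous (fun x => f x ^+ n).
Proof.
move=> cf; elim: n => [x _|n IH]; first exact: cvg_cst.
rewrite (_ : (fun x => f x ^+ n.+1) = fun x => f x * f x ^+ n).
  exact: half_continuousM.
by apply/funext => x; rewrite exprS.
Qed.

Lemma half_continuous_cst (e : R) : half_continuous (fun=> e).
Proof. by move=> x _; exact: cvg_cst. Qed.

Lemma half_continuousB f g : half_continuous f -> half_continuous g ->
  half_continuous (fun x => f x - g x).
Proof. by move=> cf cg x x0; apply: cvgB; [exact: cf|exact: cg]. Qed.

(** Integrating from [-1] makes the point [0] interior, so that the derivative there
    is two-sided. *)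
Definition primitive g x : R := \int[mu]_(t in `[-1, x]) g `|t|.

Lemma is_derive_primitive g x : half_continuous g -> 0 <= x ->
  der (primitive g) x (g x).
Proof.
move=> cg x0; have cg' := half_continuous_even cg.
have [||||dv E] := @continuous_FTC1_closed R (fun t => g `|t|) (-1) x (x + 1).
- by rewrite ltrDl.
- apply: continuous_compact_integrable; first exact: segment_compact.
  exact: continuous_subspaceT.
- by rewrite (lt_le_trans _ x0) ?ltrN10.
- exact: cg'.
by split=> //; rewrite -derive1E E ger0_norm.
Qed.

Lemma increment_le f f' H H' x y : (forall z, 0 <= z -> der f z (f' z)) ->
  (forall z, 0 <= z -> der H z (H' z)) -> (forall z, 0 <= z -> `|f' z| <= H' z) ->
  0 <= x -> x <= y -> `|f y - f x| <= H y - H x.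
Proof.
move=> df dH fH x0 xy.
have A : H x - f x <= H y - f y.
  apply: (@ge0_derive_le _ (fun z => H z - f z) (fun z => H' z - f' z) 0) => // z z0.
    by apply: is_derive_addf; [exact: dH|apply: is_derive_oppf; exact: df].
  by rewrite subr_ge0 (le_trans (ler_norm _) (fH _ z0)).
have B : H x + f x <= H y + f y.
  apply: (@ge0_derive_le _ (fun z => H z + f z) (fun z => H' z + f' z) 0) => // z z0.
    by apply: is_derive_addf; [exact: dH|exact: df].
  by rewrite -(opprK (f' z)) subr_ge0 (le_trans (ler_norm _)) // normrN fH.
by rewrite ler_norml; apply/andP; split; lra.
Qed.

Lemma nondecreasing_cvgy f M : (forall x y, 0 <= x -> x <= y -> f x <= f y) ->
  (forall x, 0 <= x -> f x <= M) -> cvg (f x @[x --> +oo]).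
Proof.
move=> fi fM; pose g x := f (Num.max 0 x).
have /nondecreasing_cvgr gl : {homo g : x y / x <= y}.
  move=> x y xy; apply: fi; first by rewrite le_max lexx.
  by rewrite ge_max !le_max lexx /= xy orbT.
apply/cvg_ex; exists (sup (range g)).
apply: cvg_trans (gl _); last by exists M => _ [x _ <-]; apply: fM; rewrite le_max lexx.
apply: near_eq_cvg; near=> x; rewrite /g max_r //.
Unshelve. all: by end_near. Qed.

(** The primitives used below vanish at the origin ([s = true]) or at infinity
    ([s = false]).  A bound [H >= 0] of such a primitive increases, respectively
    decreases, which is the meaning of the sign in [dominated]. *)
Definition sgn s : R := if s then 1 else -1.

Definition base_value s g : R :=
  if s then primitive g 0 else lim (primitive g x @[x --> +oo]).

Definition primitive_from s g x : R := primitive g x - base_value s g.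

Definition dominated s g H := exists H',
  [/\ forall x, 0 <= x -> der H x (H' x), forall x, 0 <= x -> 0 <= H x &
      forall x, 0 <= x -> `|g x| <= sgn s * H' x].

Lemma is_derive_primitive_from s g x : half_continuous g -> 0 <= x ->
  der (primitive_from s g) x (g x).
Proof.
move=> cg x0; apply: is_derive_val (is_derive_addf (is_derive_primitive cg x0)
  (is_derive_cstf (- base_value s g) x)).
by rewrite addr0.
Qed.

Lemma primitive_from0 g : primitive_from true g 0 = 0.
Proof. by rewrite /primitive_from subrr. Qed.

(** [f - H] and [- H] are nondecreasing and bounded above. *)
Lemma dominated_cvg f f' H : (forall x, 0 <= x -> der f x (f' x)) ->
  dominated false f' H -> cvg (f x @[x --> +oo]).
Proof.
move=> df [H' [dH H0 gH]].
have I x y := @increment_le f f' (fun z => - H z) (fun z => - H' z) x y df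
  (fun z hz => is_derive_oppf (dH z hz)).
have fH z : 0 <= z -> `|f' z| <= - H' z.
  by move=> z0; have := gH z z0; rewrite /sgn mulN1r.
have {}I x y : 0 <= x -> x <= y -> `|f y - f x| <= H x - H y.
  by move=> x0 xy; have := I x y fH x0 xy; lra.
have cA : cvg (f x - H x @[x --> +oo]).
  apply: (@nondecreasing_cvgy _ (f 0 + H 0)) => [x y x0 xy|x x0].
    by have := I x y x0 xy; rewrite ler_norml => /andP[]; lra.
  have := I 0 x (lexx 0) x0; rewrite ler_norml => /andP[].
  by have := H0 x x0; lra.
have cB : cvg (- H x @[x --> +oo]).
  apply: (@nondecreasing_cvgy _ 0) => [x y x0 xy|x x0]; last by rewrite oppr_le0 H0.
  by have := le_trans (normr_ge0 _) (I x y x0 xy); lra.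
have -> : f = (fun x => f x - H x) - (fun x => - H x).
  by apply/funext => x; rewrite !fctE opprK subrK.
exact: is_cvgB cA cB.
Qed.

Lemma limit_le f l x e : f y @[y --> +oo] --> l ->
  (forall y, x <= y -> `|f y - f x| <= e) -> `|l - f x| <= e.
Proof.
move=> fl fe; apply/ler_addgt0Pl => d d0.
have /cvgrPdist_le/(_ d d0) A := fl.
have [y [Hy xy]] : exists y, `|l - f y| <= d /\ x <= y.
  apply: (@filter_ex _ (+oo : set_system R)).
  by near=> y; split; near: y => //; apply: nbhs_pinfty_ge; rewrite num_real.
have -> : l - f x = (l - f y) + (f y - f x) by ring.
by apply: le_trans (ler_normD _ _) _; rewrite lerD // fe.
Unshelve. all: by end_near. Qed.

Lemma primitive_from_sub_le s g1 g2 H1 H2 H x :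
  half_continuous g1 -> half_continuous g2 ->
  dominated s g1 H1 -> dominated s g2 H2 ->
  dominated s (fun y => g1 y - g2 y) H ->
  0 <= x -> `|primitive_from s g1 x - primitive_from s g2 x| <= H x.
Proof.
move=> c1 c2 d1 d2 [H' [dH H0 gH]] x0.
pose f y := primitive g1 y - primitive g2 y.
have df y : 0 <= y -> der f y (g1 y - g2 y).
  move=> y0; apply: is_derive_addf; first exact: is_derive_primitive.
  by apply: is_derive_oppf; exact: is_derive_primitive.
case: s d1 d2 gH => d1 d2 gH.
  have -> : primitive_from true g1 x - primitive_from true g2 x = f x - f 0.
    by rewrite /primitive_from /f /=; ring.
  have fH z : 0 <= z -> `|g1 z - g2 z| <= H' z.
    by move=> z0; have := gH z z0; rewrite /sgn mul1r.
  have := increment_le df dH fH (lexx 0) x0.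
  by have := H0 0 (lexx 0); lra.
have e1 := dominated_cvg (fun y => is_derive_primitive c1) d1.
have e2 := dominated_cvg (fun y => is_derive_primitive c2) d2.
have fl : f y @[y --> +oo] --> base_value false g1 - base_value false g2.
  exact: cvgB e1 e2.
have -> : primitive_from false g1 x - primitive_from false g2 x =
    - ((base_value false g1 - base_value false g2) - f x).
  by rewrite /primitive_from /f /=; ring.
rewrite normrN; apply: (limit_le fl) => y xy.
have fH z : 0 <= z -> `|g1 z - g2 z| <= - H' z.
  by move=> z0; have := gH z z0; rewrite /sgn mulN1r.
have := @increment_le f _ (fun z => - H z) (fun z => - H' z) x y df
  (fun z hz => is_derive_oppf (dH z hz)) fH x0 xy.
have Hy : 0 <= H y by apply: H0; apply: le_trans xy.
by move=> h; apply: le_trans h _; lra.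
Qed.

Lemma primitive_from_zero s x : primitive_from s (fun=> 0) x = 0.
Proof.
have p0 : primitive (fun=> 0) = (fun=> 0) :> (R -> R).
  by apply/funext => y; rewrite /primitive Rintegral_cst // mul0r.
by rewrite /primitive_from /base_value p0; case: s; rewrite ?lim_cst ?subr0.
Qed.

Lemma primitive_from_le s g H x : half_continuous g -> dominated s g H ->
  0 <= x -> `|primitive_from s g x| <= H x.
Proof.
move=> cg dg x0; have c0 : half_continuous (fun=> 0) by move=> y _; exact: cvg_cst.
have d0 : dominated s (fun=> 0) (fun=> 0).
  exists (fun=> 0); split=> // [y _|y _]; first exact: is_derive_cstf.
  by rewrite normr0 mulr0.
have := @primitive_from_sub_le s g (fun=> 0) H (fun=> 0) H x cg c0 dg d0.
rewrite primitive_from_zero subr0; apply => //.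
by under eq_fun do rewrite subr0.
Qed.

End Primitives.

(** * Contractions in weighted spaces *)

Section FixedPoint.
Context {R : realType}.

Lemma le_geometric (x y C : R) : (forall n, x <= y + C * 2^-1 ^+ n) -> x <= y.
Proof.
move=> H; rewrite leNgt; apply/negP => yx.
have C0 : 0 < C.
  by rewrite ltNge; apply/negP => C0; have := H 0%N; rewrite expr0 mulr1; lra.
pose n := (Num.truncn (C / (x - y))).+1.
have Hn : C / (x - y) < n%:R by rewrite truncnS_gt.
have n2 : n%:R < 2 ^+ n :> R by rewrite -natrX ltr_nat ltn_expl.
have p2 : 0 < 2 ^+ n :> R by rewrite exprn_gt0.
have := H n; rewrite exprVn; apply/negP; rewrite -ltNge.
rewrite -ltrBrDl ltr_pdivrMr //.
move: (lt_trans Hn n2); rewrite ltr_pdivrMr ?subr_gt0 //.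
by rewrite mulrC.
Qed.

(** Banach's fixed point theorem, on functions bounded by a multiple of a weight
    [w].  The class [P] is the regularity that [T] needs and that passes to
    [w]-uniform limits.  The limit of the iterates is taken pointwise, as the
    supremum of the lower bounds that the geometric estimate provides. *)
Lemma weighted_fixed_point (D : Type) (w : D -> R) (P : (D -> R) -> Prop)
    (T : (D -> R) -> D -> R) (rho : R) :
  (forall d, 0 <= w d) -> 0 <= rho -> P (fun=> 0) ->
  (forall u, P u -> (forall d, `|u d| <= rho * w d) ->
    P (T u) /\ forall d, `|T u d| <= rho * w d) ->
  (forall u v c, P u -> P v ->
    (forall d, `|u d| <= rho * w d) -> (forall d, `|v d| <= rho * w d) ->
    0 <= c -> (forall d, `|u d - v d| <= c * w d) ->
    forall d, `|T u d - T v d| <= c / 2 * w d) ->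
  (forall (u_ : nat -> D -> R) v, (forall n, P (u_ n)) ->
    (forall n d, `|u_ n d - v d| <= 2 * rho * 2^-1 ^+ n * w d) -> P v) ->
  exists u, [/\ P u, forall d, `|u d| <= rho * w d & forall d, T u d = u d].
Proof.
move=> w0 rho0 P0 TP Tlip Pcl.
pose u_ n := iter n T (fun=> 0).
have uS n : u_ n.+1 = T (u_ n) by [].
have [uP uB] : (forall n, P (u_ n)) /\ (forall n d, `|u_ n d| <= rho * w d).
  suff H n : P (u_ n) /\ forall d, `|u_ n d| <= rho * w d.
    by split=> n; have [] := H n.
  elim: n => [|n [IH1 IH2]]; last by rewrite uS; exact: TP.
  by split=> // d; rewrite normr0 mulr_ge0.
have q0 n : 0 <= 2^-1 ^+ n :> R by rewrite exprn_ge0.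
have step n d : `|u_ n.+1 d - u_ n d| <= rho * 2^-1 ^+ n * w d.
  elim: n d => [|n IH] d; first by rewrite subr0 expr0 mulr1 uB.
  rewrite !uS; apply: le_trans (Tlip _ _ _ _ _ _ _ _ IH d) _ => //.
    by rewrite mulr_ge0.
  by rewrite exprSr mulrA.
pose c n d := 2 * rho * 2^-1 ^+ n * w d.
have cS n d : c n d = rho * 2^-1 ^+ n * w d + c n.+1 d.
  by rewrite /c exprSr; field.
have incr d m n : u_ n d - c n d <= u_ (m + n)%N d - c (m + n)%N d.
  elim: m => [|m IH] //; apply: le_trans IH _; rewrite addSn (cS (m + n)%N d).
  by have := step (m + n)%N d; rewrite ler_norml => /andP[]; lra.
have decr d m n : u_ (m + n)%N d + c (m + n)%N d <= u_ n d + c n d.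
  elim: m => [|m IH] //; apply: le_trans IH; rewrite addSn (cS (m + n)%N d).
  by have := step (m + n)%N d; rewrite ler_norml => /andP[]; lra.
have c0 n d : 0 <= c n d by rewrite /c !mulr_ge0.
have sep d m n : u_ m d - c m d <= u_ n d + c n d.
  apply: le_trans (incr d n m) _; rewrite addnC; apply: le_trans _ (decr d m n).
  by have := c0 (m + n)%N d; lra.
pose S d := range (fun n => u_ n d - c n d).
have hS d : has_sup (S d).
  by split; [exists (u_ 0%N d - c 0%N d), 0%N|exists (u_ 0%N d + c 0%N d) => _ [m _ <-]; exact: sep].
pose v d := sup (S d).
have uv n d : `|u_ n d - v d| <= c n d.
  have A : u_ n d - c n d <= v d by apply: sup_upper_bound => //; exists n.
  have B : v d <= u_ n d + c n d.
    by apply: ge_sup; [exact: (hS d).1|move=> _ [m _ <-]; exact: sep].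
  by rewrite ler_norml; apply/andP; split; lra.
have Pv : P v by apply: Pcl uP uv.
have vB d : `|v d| <= rho * w d.
  apply: (@le_geometric _ _ (2 * rho * w d)) => n.
  have -> : v d = u_ n d - (u_ n d - v d) by ring.
  apply: le_trans (ler_normB _ _) _; rewrite lerD //; apply: le_trans (uv n d) _.
  by rewrite /c mulrAC.
exists v; split=> // d; apply/eqP; rewrite -subr_eq0 -normr_le0.
apply: (@le_geometric _ _ (2 * (2 * rho * w d))) => n; rewrite add0r.
have -> : T v d - v d = (T v d - T (u_ n) d) + (u_ n.+1 d - v d).
  by rewrite uS; ring.
have A : `|T v d - T (u_ n) d| <= 2 * rho * 2^-1 ^+ n / 2 * w d.
  apply: Tlip => //; first by rewrite !mulr_ge0.
  by move=> d'; rewrite distrC; exact: uv.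
apply: le_trans (ler_normD _ _) (le_trans (lerD A (uv n.+1 d)) _).
rewrite /c exprSr.
have : 0 <= rho * 2^-1 ^+ n * w d by rewrite !mulr_ge0.
lra.
Qed.

Lemma weighted_limit_continuous (w : R -> R) (u_ : nat -> R -> R) v C :
  (forall x, 0 <= w x) -> 0 <= C ->
  continuous w -> (forall n, continuous (u_ n)) ->
  (forall n x, `|u_ n x - v x| <= C * 2^-1 ^+ n * w x) -> continuous v.
Proof.
move=> w0 C0 cw cu uv x; apply/cvgrPdist_le => e e0.
have [n Hn] : exists n, C * 2^-1 ^+ n * (w x + 1) <= e / 3.
  apply: contrapT => /forallNP H.
  suff : e / 3 <= 0 by lra.
  apply: (@le_geometric _ _ (C * (w x + 1))) => n; rewrite add0r.
  by have /negP := H n; rewrite -ltNge mulrAC => /ltW.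
have q0 : 0 <= C * 2^-1 ^+ n by rewrite mulr_ge0 ?exprn_ge0.
have wx : C * 2^-1 ^+ n * w x <= e / 3.
  by apply: le_trans Hn; rewrite ler_wpM2l //; lra.
have /cvgrPdist_le/(_ 1 ltr01) cwx := cw x.
have e3 : 0 < e / 3 by lra.
have /cvgrPdist_le/(_ _ e3) cux := cu n x.
near=> y.
have A : `|w x - w y| <= 1 by near: y.
have B : `|u_ n x - u_ n y| <= e / 3 by near: y.
have -> : v x - v y = - (u_ n x - v x) + (u_ n x - u_ n y) + (u_ n y - v y) by ring.
apply: le_trans (ler_normD _ _) _; apply: le_trans (lerD (ler_normD _ _) (lexx _)) _.
rewrite normrN.
have D : `|u_ n y - v y| <= e / 3.
  apply: le_trans (uv n y) (le_trans _ Hn); rewrite ler_wpM2l //.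
  by move: A; rewrite ler_norml => /andP[]; lra.
have E := le_trans (uv n x) wx; lra.
Unshelve. all: by end_near. Qed.

End FixedPoint.

(** * Volterra equations *)

Section Volterra.
Context {R : realType}.
Implicit Types (x y : R) (s : bool) (u v g : R -> R).
Variables (l m C : R) (V : R -> R).
Hypotheses (l0 : 0 < l) (m0 : 0 < m) (C0 : 0 <= C).
Hypothesis cV : half_continuous V.
Hypothesis VC : forall x, 0 <= x -> `|V x| <= C * expR (- m * x).

(** Variation of constants for [y'' = l^2 y + g]: the terms are primitives from
    the origin or from infinity, according to [s]. *)
Definition variation s (g : R -> R) (x : R) : R := (2 * l)^-1 *
  (expR (l * x) * primitive_from s (fun t => expR (- l * t) * g t) x -
   expR (- l * x) * primitive_from s (fun t => expR (l * t) * g t) x).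

Definition variation1 s (g : R -> R) (x : R) : R := 2^-1 *
  (expR (l * x) * primitive_from s (fun t => expR (- l * t) * g t) x +
   expR (- l * x) * primitive_from s (fun t => expR (l * t) * g t) x).

Lemma half_continuous_expM k (g : R -> R) : half_continuous g ->
  half_continuous (fun t => expR (k * t) * g t).
Proof.
move=> cg; apply: half_continuousM => // x _.
exact: is_derive_cont (is_derive_expl k x).
Qed.

Lemma is_derive_variation s g x : half_continuous g -> 0 <= x ->
  der (variation s g) x (variation1 s g x) /\
  der (variation1 s g) x (l ^+ 2 * variation s g x + g x).
Proof.
move=> cg x0.
have dm := is_derive_primitive_from s (half_continuous_expM (k := - l) cg) x0.
have dp := is_derive_primitive_from s (half_continuous_expM (k := l) cg) x0.
have em := is_derive_expl (- l) x; have ep := is_derive_expl l x.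
have A := is_derive_mulf ep dm; have B := is_derive_mulf em dp.
have EE : expR (l * x) * expR (- l * x) = 1 by rewrite mulNr expRxMexpNx_1.
have EG : expR (l * x) * (expR (- l * x) * g x) = g x by rewrite mulrA EE mul1r.
have EG' : expR (- l * x) * (expR (l * x) * g x) = g x.
  by rewrite mulrA [_ * expR (l * x)]mulrC EE mul1r.
split.
  apply: is_derive_val (is_derive_cmulf (2 * l)^-1
    (is_derive_addf A (is_derive_oppf B))).
  rewrite /variation1 EG EG'.
  move: (primitive_from _ _ _) (primitive_from _ _ _) => a b.
  by field; rewrite gt_eqF.
apply: is_derive_val (is_derive_cmulf 2^-1 (is_derive_addf A B)).
rewrite /variation EG EG'.
move: (primitive_from _ _ _) (primitive_from _ _ _) => a b.
by field; rewrite gt_eqF.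
Qed.

(* A factor with this [K] brings the Lipschitz constant of the operator, which
   is at most [C / (l * K * m)], below [1 / 2]. *)
Let K := 2 * C / (l * m) + 1.
Let K0 : 0 < K.
Proof. by rewrite ltr_wpDl // divr_ge0 ?mulr_ge0 // ltW // mulr_gt0. Qed.

(** This factor turns the Volterra operator into a contraction: it increases in
    the direction in which the primitives are taken, fast enough where [V] is
    large, and stays between two positive constants. *)
Let E s x := expR (- sgn s * K * expR (- m * x)).

Let is_derive_E s x : der (E s) x (sgn s * (K * m * expR (- m * x)) * E s x).
Proof.
apply: is_derive_val (is_derive_expf (is_derive_cmulf _ (is_derive_expl (- m) x))).
by rewrite /E; ring.
Qed.

Let sgn2 s : @sgn R s * sgn s = 1.
Proof. by case: s => /=; rewrite ?mulrNN mulr1. Qed.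

Let E_bounds s x : 0 <= x -> expR (- K) <= E s x <= expR K.
Proof.
move=> x0; rewrite /E !ler_expR.
have e0 := expR_gt0 (- m * x).
have e1 : expR (- m * x) <= 1 by rewrite expR_le1 mulNr oppr_le0 mulr_ge0 // ltW.
have A : 0 <= K * expR (- m * x) <= K.
  by rewrite mulr_ge0 ?ler_piMr // ltW.
by move: A => /andP[]; case: s; rewrite /sgn ?opprK ?mulN1r ?mul1r => *; apply/andP; split; lra.
Qed.

Let w s (x : R) := expR (sgn s * l * x) * E s x.

Let w0 s x : 0 <= w s x. Proof. by rewrite mulr_ge0 ?expR_ge0. Qed.

(** The exponential in front has rate [l] or [- l]; in both cases the product with
    [exp (sgn s * l x)] is monotone in the direction of integration, and the decay
    of [V] is absorbed by the derivative of [E]. *)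
Lemma dominated_volterra s s' c u : 0 <= c ->
  (forall x, 0 <= x -> `|u x| <= c * w s x) ->
  dominated s (fun t => expR (sgn s' * l * t) * (V t * u t))
    (fun t => c * C / (K * m) * (expR ((sgn s' + sgn s) * l * t) * E s t)).
Proof.
move=> c0 uc; have k0 : 0 <= c * C / (K * m).
  by rewrite divr_ge0 ?mulr_ge0 // ltW // mulr_gt0.
exists (fun x => c * C / (K * m) * ((sgn s' + sgn s) * l *
    expR ((sgn s' + sgn s) * l * x) * E s x +
    expR ((sgn s' + sgn s) * l * x) * (sgn s * (K * m * expR (- m * x)) * E s x))).
split=> [x _|x _|x x0].
- exact: is_derive_cmulf (is_derive_mulf (is_derive_expl _ x) (is_derive_E s x)).
- by rewrite mulr_ge0 // mulr_ge0 ?expR_ge0.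
rewrite !normrM [`|expR _|]ger0_norm ?expR_ge0 //.
have ss : 0 <= sgn s * (sgn s' + sgn s) :> R.
  by rewrite /sgn; case: s s' {uc} => [] []; lra.
set P := expR ((sgn s' + sgn s) * l * x) * E s x.
have P0 : 0 <= P by rewrite mulr_ge0 ?expR_ge0.
have -> : sgn s * (c * C / (K * m) * ((sgn s' + sgn s) * l *
    expR ((sgn s' + sgn s) * l * x) * E s x +
    expR ((sgn s' + sgn s) * l * x) * (sgn s * (K * m * expR (- m * x)) * E s x)))
  = c * C / (K * m) * (sgn s * (sgn s' + sgn s)) * l * P +
    c * C * expR (- m * x) * P * (sgn s * sgn s).
  by rewrite /P; field; rewrite !gt_eqF.
rewrite sgn2 mulr1 -[leLHS]add0r lerD //.
  by apply: mulr_ge0 => //; apply: mulr_ge0 (ltW l0); exact: mulr_ge0.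
have -> : c * C * expR (- m * x) * P =
    expR (sgn s' * l * x) * ((C * expR (- m * x)) * (c * w s x)).
  by rewrite /P /w !mulrDl expRD; ring.
by rewrite ler_wpM2l ?expR_ge0 // ler_pM // ?VC // uc.
Qed.

Let variation_lip s c c1 c2 u v x : half_continuous u -> half_continuous v ->
  0 <= c -> 0 <= c1 -> 0 <= c2 ->
  (forall x, 0 <= x -> `|u x| <= c1 * w s x) ->
  (forall x, 0 <= x -> `|v x| <= c2 * w s x) ->
  (forall x, 0 <= x -> `|u x - v x| <= c * w s x) -> 0 <= x ->
  `|variation s (fun t => V t * u t) x - variation s (fun t => V t * v t) x|
    <= c / 2 * w s x.
Proof.
move=> cu cv c0 c10 c20 u1 v2 uv x0.
have key s' : `|expR (- sgn s' * l * x) *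
   (primitive_from s (fun t => expR (sgn s' * l * t) * (V t * u t)) x -
    primitive_from s (fun t => expR (sgn s' * l * t) * (V t * v t)) x)| <=
    c * C / (K * m) * w s x.
  have D : dominated s (fun t => expR (sgn s' * l * t) * (V t * u t) -
       expR (sgn s' * l * t) * (V t * v t))
     (fun t => c * C / (K * m) * (expR ((sgn s' + sgn s) * l * t) * E s t)).
    have := dominated_volterra s' c0 uv.
    by under eq_fun do rewrite !mulrBr.
  have H := primitive_from_sub_le
    (half_continuous_expM (half_continuousM cV cu))
    (half_continuous_expM (half_continuousM cV cv))
    (dominated_volterra s' c10 u1) (dominated_volterra s' c20 v2) D x0.
  rewrite normrM ger0_norm ?expR_ge0 //.
  apply: le_trans (ler_wpM2l (expR_ge0 _) H) _.
  rewrite le_eqVlt; apply/orP; left; apply/eqP.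
  rewrite /w mulrCA; congr (_ * _); rewrite mulrA -expRD; congr (expR _ * _).
  by ring.
have := key false; have := key true; rewrite /sgn opprK !mul1r !mulN1r => kt kf.
have l20 : 0 < (2 * l)^-1 by rewrite invr_gt0 mulr_gt0.
rewrite /variation.
move: (primitive_from _ _ _) (primitive_from _ _ _) kf => b a kf.
move: (primitive_from _ _ _) (primitive_from _ _ _) kt => b' a' kt.
have -> : (2 * l)^-1 * (expR (l * x) * a - expR (- l * x) * a') -
  (2 * l)^-1 * (expR (l * x) * b - expR (- l * x) * b') =
  (2 * l)^-1 * (expR (l * x) * (a - b) - expR (- l * x) * (a' - b')) by ring.
rewrite normrM (gtr0_norm l20).
apply: le_trans (ler_wpM2l (ltW l20) (le_trans (ler_normB _ _) (lerD kf kt))) _.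
have -> : (2 * l)^-1 *
    (c * C / (K * m) * w s x + c * C / (K * m) * w s x) =
  (2 * C / (l * m)) / K * (c / 2 * w s x) by field; rewrite !gt_eqF.
apply: ler_piMl; first by rewrite mulr_ge0 ?divr_ge0.
by rewrite ler_pdivrMr // mul1r /K lerDl ler01.
Qed.

(** The fixed point is a solution of [y'' = (l^2 + V) y] when [phi0] solves
    [y'' = l^2 y].  Taking the primitives from infinity, the perturbed solution
    keeps the decay of [exp (- l x)]; taking them from the origin, it keeps the
    Cauchy data of [phi0] at the origin. *)
Lemma volterra s (phi0 : R -> R) k0 : 0 <= k0 -> half_continuous phi0 ->
  (forall x, 0 <= x -> `|phi0 x| <= k0 * expR (sgn s * l * x)) ->
  exists phi B, [/\ continuous phi, 0 <= B,
    forall x, 0 <= x -> `|phi x| <= B * expR (sgn s * l * x) &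
    forall x, 0 <= x -> phi x = phi0 x + variation s (fun t => V t * phi t) x].
Proof.
move=> k00 cphi0 phik.
pose T (u : R -> R) x := phi0 `|x| + variation s (fun t => V t * u t) `|x|.
pose rho := 2 * k0 * expR K.
have rho0 : 0 <= rho by rewrite !mulr_ge0 ?expR_ge0.
have hc (u : R -> R) : continuous u -> half_continuous u by move=> cu x _; exact: cu.
have half (u : R -> R) c : (forall x, `|u x| <= c * w s `|x|) ->
    forall x, 0 <= x -> `|u x| <= c * w s x.
  by move=> H x x0; have := H x; rewrite (ger0_norm x0).
have v0 x : variation s (fun t => V t * 0) x = 0.
  have z k y : primitive_from s (fun t => expR (k * t) * (V t * 0)) y = 0.
    by under eq_fun do rewrite !mulr0; exact: primitive_from_zero.
  by rewrite /variation !z !mulr0 subr0 mulr0.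
have [|||||phi [cphi phiB phiT]] := @weighted_fixed_point R R (fun x => w s `|x|)
    (fun u => continuous u) T rho _ rho0.
- by move=> d; exact: w0.
- by move=> x; exact: cvg_cst.
- move=> u cu uB; split.
    have := @half_continuous_even R
      (fun x => phi0 x + variation s (fun t => V t * u t) x).
    apply => x x0; apply: cvgD; first exact: cphi0.
    have [dv _] := is_derive_variation s (half_continuousM cV (hc _ cu)) x0.
    exact: is_derive_cont dv.
  move=> d; apply: le_trans (ler_normD _ _) _.
  have d0 := normr_ge0 d.
  have h0 : half_continuous (fun=> 0 : R) by move=> y _; exact: cvg_cst.
  have A := @variation_lip s rho rho 0 u (fun=> 0) `|d| (hc _ cu) h0
    rho0 rho0 (lexx 0) (half _ _ uB).
  have {A} : `|variation s (fun t => V t * u t) `|d| | <= rho / 2 * w s `|d|.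
    have := A _ _ d0; rewrite v0 subr0; apply => y y0.
      by rewrite normr0 mul0r.
    by rewrite subr0; exact: half uB y y0.
  suff : `|phi0 `|d| | <= rho / 2 * w s `|d| by lra.
  apply: le_trans (phik _ d0) _.
  have -> : rho / 2 * w s `|d| = k0 * (expR (sgn s * l * `|d|) * (expR K * E s `|d|)).
    by rewrite /rho /w; field.
  rewrite ler_wpM2l // ler_peMr ?expR_ge0 // -(expRxMexpNx_1 K).
  by rewrite ler_wpM2l ?expR_ge0 //; have /andP[] := E_bounds s d0.
- move=> u v c cu cv uB vB c0 uv d.
  rewrite /T opprD addrACA subrr add0r.
  by apply: (variation_lip (hc _ cu) (hc _ cv) c0 rho0 rho0) => //; exact: half.
- move=> u_ v cu uv.
  apply: (@weighted_limit_continuous _ (fun x => w s `|x|) u_ v (2 * rho)) => //.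
    by rewrite mulr_ge0.
  have := @half_continuous_even R (w s); apply => x x0.
  exact: is_derive_cont (is_derive_mulf (is_derive_expl _ x) (is_derive_E s x)).
exists phi, (rho * expR K); split=> //.
- by rewrite mulr_ge0 ?expR_ge0.
- move=> x x0; apply: le_trans (half _ _ phiB x x0) _.
  rewrite -mulrA ler_wpM2l // /w mulrC ler_wpM2r ?expR_ge0 //.
  by have /andP[] := E_bounds s x0.
- by move=> x x0; rewrite -[LHS]phiT /T ger0_norm.
Qed.

End Volterra.

(** * Second order equations with an exponentially decaying potential *)

Section LinearTheory.
Context {R : realType}.
Implicit Types (x y : R) (s : bool) (g h u : R -> R).

Lemma dominated_exp s g k A : 0 < sgn s * k -> 0 <= A ->
  (forall x, 0 <= x -> `|g x| <= A * expR (k * x)) ->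
  dominated s g (fun x => A / (sgn s * k) * expR (k * x)).
Proof.
move=> k0 A0 gA; have kk : sgn s * sgn s = 1 :> R.
  by rewrite /sgn; case: s {k0}; rewrite ?mulrNN mulr1.
exists (fun x => A / (sgn s * k) * (k * expR (k * x))); split=> [x _|x _|x x0].
- exact: is_derive_cmulf (is_derive_expl k x).
- by rewrite mulr_ge0 ?expR_ge0 // divr_ge0 // ltW.
apply: le_trans (gA x x0) _.
have -> : sgn s * (A / (sgn s * k) * (k * expR (k * x))) =
   A * expR (k * x) * ((sgn s * k) / (sgn s * k)) by ring.
by rewrite divff ?gt_eqF // mulr1.
Qed.

Definition solves (q phi phi' : R -> R) := forall x, 0 <= x ->
  der phi x (phi' x) /\ der phi' x (q x * phi x).

Lemma solves_continuous q phi phi' : solves q phi phi' -> half_continuous phi.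
Proof. by move=> sol x /sol[d _]; exact: is_derive_cont d. Qed.

Lemma wronskian_cst q phi phi' psi psi' x :
  solves q phi phi' -> solves q psi psi' -> 0 <= x ->
  phi x * psi' x - phi' x * psi x = phi 0 * psi' 0 - phi' 0 * psi 0.
Proof.
move=> s1 s2 x0.
apply: (@derive0_cst _ (fun x => phi x * psi' x - phi' x * psi x) 0 x) => // y y0.
have [d1 d1'] := s1 y y0; have [d2 d2'] := s2 y y0.
apply: is_derive_val (is_derive_addf (is_derive_mulf d1 d2')
  (is_derive_oppf (is_derive_mulf d1' d2))).
by ring.
Qed.

(** Gronwall: the energy [phi^2 + phi'^2] grows at rate at most [1 + B]. *)
Lemma solves_zero q phi phi' B : solves q phi phi' -> 0 <= B ->
  (forall x, 0 <= x -> `|q x| <= B) -> phi 0 = 0 -> phi' 0 = 0 ->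
  forall x, 0 <= x -> phi x = 0.
Proof.
move=> sol B0 qB p0 p0' x x0.
pose e x := expR (- (1 + B) * x) * (phi x * phi x + phi' x * phi' x).
pose e' x := - (1 + B) * expR (- (1 + B) * x) * (phi x * phi x + phi' x * phi' x) +
  expR (- (1 + B) * x) * (phi' x * phi x + phi x * phi' x +
     (q x * phi x * phi' x + phi' x * (q x * phi x))).
have : - e 0 <= - e x.
  apply: (@ge0_derive_le _ (fun y => - e y) (fun y => - e' y) 0) => [y y0|y y0||]; last 2 first.
  - exact: lexx.
  - exact: x0.
  - have [d d'] := sol y y0; apply: is_derive_oppf.
    exact: is_derive_mulf (is_derive_expl _ y)
      (is_derive_addf (is_derive_mulf d d) (is_derive_mulf d' d')).
  have -> : - e' y = expR (- (1 + B) * y) * ((1 + B) * (phi y ^+ 2 + phi' y ^+ 2) -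
     2 * (1 + q y) * (phi y * phi' y)) by rewrite /e'; ring.
  rewrite mulr_ge0 ?expR_ge0 //.
  have := qB y y0; rewrite ler_norml => /andP[q1 q2].
  have A : 0 <= (phi y - phi' y) ^+ 2 by exact: sqr_ge0.
  have A' : 0 <= (phi y + phi' y) ^+ 2 by exact: sqr_ge0.
  have -> : (1 + B) * (phi y ^+ 2 + phi' y ^+ 2) - 2 * (1 + q y) * (phi y * phi' y)
    = ((B - q y) * (phi y + phi' y) ^+ 2
       + (2 + B + q y) * (phi y - phi' y) ^+ 2) / 2 by field.
  by rewrite divr_ge0 // addr_ge0 // mulr_ge0 //; lra.
rewrite lerN2 /e p0 p0' !mulr0 addr0 mulr0 pmulr_rle0 ?expR_gt0 // => H.
have A : 0 <= phi x ^+ 2 by exact: sqr_ge0.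
have A' : 0 <= phi' x ^+ 2 by exact: sqr_ge0.
apply/eqP; rewrite -sqrf_eq0; apply/eqP; rewrite !expr2 in A A' *; lra.
Qed.

(** The inverse of [- y'' + q y] with the Neumann condition at the origin, for
    right-hand sides that decay at rate [g]; [M] bounds its norm for the weight
    [exp (- g x)].  The last clause replaces the linearity of [G]. *)
Definition neumann_inverse (q : R -> R) (g : R) (G : (R -> R) -> R -> R) (M : R) :=
  0 <= M /\
  forall h (K : R), half_continuous h -> 0 <= K ->
    (forall x, 0 <= x -> `|h x| <= K * expR (- g * x)) ->
    [/\ exists r', [/\ forall x, 0 <= x -> der (G h) x (r' x),
          forall x, 0 <= x -> der r' x (q x * G h x - h x) & r' 0 = 0],
        forall x, 0 <= x -> `|G h x| <= M * K * expR (- g * x) &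
        forall (h2 : R -> R) (K2 D : R) x, half_continuous h2 -> 0 <= K2 -> 0 <= D ->
          (forall x, 0 <= x -> `|h2 x| <= K2 * expR (- g * x)) ->
          (forall x, 0 <= x -> `|h x - h2 x| <= D * expR (- g * x)) -> 0 <= x ->
          `|G h x - G h2 x| <= M * D * expR (- g * x)].

Section Equation.
Variables (l m C : R) (V : R -> R).
Hypotheses (l0 : 0 < l) (m0 : 0 < m) (C0 : 0 <= C).
Hypothesis cV : half_continuous V.
Hypothesis VC : forall x, 0 <= x -> `|V x| <= C * expR (- m * x).
Let q x := l ^+ 2 + V x.

Let solves_variation s (phi0 phi0' phi : R -> R) : continuous phi ->
  (forall x, 0 <= x -> der phi0 x (phi0' x)) ->
  (forall x, 0 <= x -> der phi0' x (l ^+ 2 * phi0 x)) ->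
  (forall x, 0 <= x -> phi x = phi0 x + variation l s (fun t => V t * phi t) x) ->
  solves q (fun x => phi0 x + variation l s (fun t => V t * phi t) x)
    (fun x => phi0' x + variation1 l s (fun t => V t * phi t) x).
Proof.
move=> cphi d0 d0' E x x0.
have cg : half_continuous (fun t => V t * phi t).
  by apply: half_continuousM => // y _; exact: cphi.
have [d1 d2] := is_derive_variation l0 s cg x0.
split; first exact: is_derive_addf (d0 x x0) d1.
apply: is_derive_val (is_derive_addf (d0' x x0) d2).
by rewrite [phi x]E // /q; move: (variation _ _ _ _) => a; ring.
Qed.

(** The difference with [exp (- l x)] is smaller by a factor [exp (- m x)], so that
    the solution is eventually positive. *)
Lemma jost_solution : exists phi phi' B X,
  [/\ solves q phi phi', 0 <= B, 0 <= X,
      forall x, 0 <= x -> `|phi x| <= B * expR (- l * x) &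
      forall x, X <= x -> 0 < phi x].
Proof.
have c0 : half_continuous (fun x => expR (- l * x)).
  by move=> x _; exact: is_derive_cont (is_derive_expl _ x).
have [x x0|phi [B [cphi B0 phiB E]]] :=
    @volterra R l m C V l0 m0 C0 cV VC false _ 1 ler01 c0.
  by rewrite ger0_norm ?expR_ge0 // mul1r /sgn mulN1r.
rewrite /sgn mulN1r in phiB.
have sol := @solves_variation false (fun x => expR (- l * x))
  (fun x => - l * expR (- l * x)) phi cphi (fun x _ => is_derive_expl (- l) x).
have {}sol := sol _ E.
exists (fun x => expR (- l * x) + variation l false (fun t => V t * phi t) x),
  (fun x => - l * expR (- l * x) + variation1 l false (fun t => V t * phi t) x), B.
pose D := (2 * l)^-1 * (B * C / (2 * l + m) + B * C / m).
have lm : 0 < 2 * l + m by rewrite addr_gt0 // mulr_gt0.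
have BC : 0 <= B * C by rewrite mulr_ge0.
have D0 : 0 <= D.
  by rewrite mulr_ge0 // ?invr_ge0 ?addr_ge0 ?divr_ge0 ?mulr_ge0 // ltW.
exists (D / m); split.
- apply: sol => x _; apply: is_derive_val (is_derive_cmulf _ (is_derive_expl _ x)).
  by ring.
- exact: B0.
- by rewrite divr_ge0 // ltW.
- by move=> x x0; rewrite -E //; exact: phiB.
move=> x Dx; have x0 : 0 <= x by apply: le_trans Dx; rewrite divr_ge0 // ltW.
suff : `|variation l false (fun t => V t * phi t) x| <= D * expR (- m * x) * expR (- l * x).
  have : D * expR (- m * x) < 1.
    apply: (@le_lt_trans _ _ (D * expR (- D))).
      by rewrite ler_wpM2l // ler_expR mulNr lerN2 mulrC -ler_pdivrMr.
    rewrite expRN ltr_pdivrMr ?expR_gt0 // mul1r.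
    by apply: lt_le_trans (expR_ge1Dx D); lra.
  move=> D1; rewrite ler_norml => /andP[H _].
  have e0 := expR_gt0 (- l * x).
  have : 0 < (1 - D * expR (- m * x)) * expR (- l * x) by rewrite mulr_gt0 // subr_gt0.
  lra.
have cg : half_continuous (fun t => V t * phi t).
  by apply: half_continuousM => // y _; exact: cphi.
have gB y : 0 <= y -> `|V y * phi y| <= B * C * expR (- (l + m) * y).
  move=> y0; rewrite normrM.
  have -> : B * C * expR (- (l + m) * y) =
    C * expR (- m * y) * (B * expR (- l * y)).
    by rewrite opprD mulrDl expRD; ring.
  by rewrite ler_pM // ?VC ?phiB.
have H k kk : k - (l + m) = - kk -> 0 < kk ->
   `|primitive_from false (fun t => expR (k * t) * (V t * phi t)) x| <=
   B * C / kk * expR (- kk * x).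
  move=> Ek kk0.
  have := @dominated_exp false (fun t => expR (k * t) * (V t * phi t)) (- kk) (B * C).
  rewrite /sgn mulrNN mul1r => /(_ kk0 BC) Hd.
  apply: (@primitive_from_le _ _ _ (fun x => B * C / kk * expR (- kk * x)) _ _ _ x0).
    exact: half_continuous_expM.
  apply: Hd => y y0; rewrite normrM ger0_norm ?expR_ge0 //.
  apply: le_trans (ler_wpM2l (expR_ge0 _) (gB y y0)) _.
  rewrite mulrCA -expRD -mulrDl ler_wpM2l // ler_expR.
  by rewrite -Ek lexx.
have H1 := H (- l) (2 * l + m) _ lm; have H2 := H l m _ m0.
have {}H1 := H1 ltac:(ring); have {}H2 := H2 ltac:(ring).
rewrite /variation normrM gtr0_norm ?invr_gt0 ?mulr_gt0 //.
have -> : D * expR (- m * x) * expR (- l * x) = (2 * l)^-1 *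
    (B * C / (2 * l + m) * expR (- m * x) * expR (- l * x) +
     B * C / m * expR (- m * x) * expR (- l * x)) by rewrite /D; ring.
rewrite ler_wpM2l ?invr_ge0 ?mulr_ge0 // ?(ltW l0) //.
apply: le_trans (ler_normB _ _) _.
apply: lerD; rewrite normrM ger0_norm ?expR_ge0 //.
  apply: le_trans (ler_wpM2l (expR_ge0 _) H1) _.
  rewrite mulrCA -[leRHS]mulrA ler_wpM2l ?divr_ge0 ?(ltW lm) //.
  have -> : expR (l * x) * expR (- (2 * l + m) * x) =
    expR (- m * x) * expR (- l * x) by rewrite -!expRD; congr expR; ring.
  by [].
apply: le_trans (ler_wpM2l (expR_ge0 _) H2) _.
rewrite mulrCA -[leRHS]mulrA ler_wpM2l ?divr_ge0 ?(ltW m0) //.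
have -> : expR (- l * x) * expR (- m * x) = expR (- m * x) * expR (- l * x).
  by rewrite mulrC.
by [].
Qed.

Lemma regular_solution : exists psi psi' B,
  [/\ solves q psi psi', 0 <= B, psi 0 = 1, psi' 0 = 0 &
      forall x, 0 <= x -> `|psi x| <= B * expR (l * x)].
Proof.
pose p0 x := 2^-1 * (expR (l * x) + expR (- l * x)).
pose p1 x := 2^-1 * (l * expR (l * x) + - l * expR (- l * x)).
have d0 x : der p0 x (p1 x).
  exact: is_derive_cmulf (is_derive_addf (is_derive_expl _ x) (is_derive_expl _ x)).
have d1 x : der p1 x (l ^+ 2 * p0 x).
  apply: is_derive_val (is_derive_cmulf _ (is_derive_addf
    (is_derive_cmulf _ (is_derive_expl l x)) (is_derive_cmulf _ (is_derive_expl (- l) x)))).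
  by rewrite /p0; ring.
have c0 : half_continuous p0 by move=> x _; exact: is_derive_cont (d0 x).
have [x x0|phi [B [cphi B0 phiB E]]] :=
    @volterra R l m C V l0 m0 C0 cV VC true _ 1 ler01 c0.
  rewrite ger0_norm; last by rewrite /p0 mulr_ge0 ?invr_ge0 ?addr_ge0 ?expR_ge0.
  rewrite mul1r /sgn mul1r.
  have : expR (- l * x) <= expR (l * x) 
    by rewrite ler_expR -subr_ge0 mulNr opprK addr_ge0 // mulr_ge0 // ltW.
  by rewrite /p0; lra.
rewrite /sgn mul1r in phiB.
exists (fun x => p0 x + variation l true (fun t => V t * phi t) x),
  (fun x => p1 x + variation1 l true (fun t => V t * phi t) x), B.
split.
- apply: solves_variation => //.
- exact: B0.
- rewrite /variation /p0 !primitive_from0 !mulr0 subrr mulr0 addr0 expR0.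
  by field.
- rewrite /variation1 /p1 !primitive_from0 !mulr0 addr0 mulr0 addr0 expR0.
  by ring.
- by move=> x x0; rewrite -E //; exact: phiB.
Qed.

(** The kernel of Green's operator is built from the solution that decays and the
    one with zero slope at the origin; they are independent exactly when the former
    has nonzero slope there.  The rate [g] is below [l], for the decay of the
    right-hand side to be the slower one. *)
Lemma green_operator (g B : R) (phi phi' : R -> R) : 0 < g -> g < l ->
  solves q phi phi' -> 0 <= B ->
  (forall x, 0 <= x -> `|phi x| <= B * expR (- l * x)) -> phi' 0 != 0 ->
  exists G M, neumann_inverse q g G M.
Proof.
move=> g0 gl sol B0 phiB p0.
have [psi [psi' [B2 [sol2 B20 psi0 psi'0 psiB]]]] := regular_solution.
have cphi := solves_continuous sol; have cpsi := solves_continuous sol2.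
pose k := - (phi' 0)^-1.
pose G h x := k * (phi x * primitive_from true (fun t => psi t * h t) x -
                   psi x * primitive_from false (fun t => phi t * h t) x).
pose M := `|k| * (B * B2 / (l - g) + B * B2 / (l + g)).
have lg : 0 < l - g by lra.
have lg' : 0 < l + g by rewrite addr_gt0.
have BB : 0 <= B * B2 by rewrite mulr_ge0.
have M0 : 0 <= M by rewrite mulr_ge0 // addr_ge0 // divr_ge0 // ltW.
have dt h K : 0 <= K -> (forall x, 0 <= x -> `|h x| <= K * expR (- g * x)) ->
    dominated true (fun t => psi t * h t)
      (fun x => B2 * K / (l - g) * expR ((l - g) * x)).
  move=> K0 hK.
  have := @dominated_exp true (fun t => psi t * h t) (l - g) (B2 * K).
  rewrite /sgn mul1r; apply=> //; first by rewrite mulr_ge0.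
  move=> x x0; rewrite normrM mulrDl expRD.
  have -> : B2 * K * (expR (l * x) * expR (- g * x)) =
    (B2 * expR (l * x)) * (K * expR (- g * x)) by ring.
  by rewrite ler_pM // ?psiB ?hK.
have df h K : 0 <= K -> (forall x, 0 <= x -> `|h x| <= K * expR (- g * x)) ->
    dominated false (fun t => phi t * h t)
      (fun x => B * K / (l + g) * expR (- (l + g) * x)).
  move=> K0 hK.
  have := @dominated_exp false (fun t => phi t * h t) (- (l + g)) (B * K).
  rewrite /sgn mulrNN mul1r; apply=> //; first by rewrite mulr_ge0.
  move=> x x0; rewrite normrM opprD mulrDl expRD.
  have -> : B * K * (expR (- l * x) * expR (- g * x)) =
    (B * expR (- l * x)) * (K * expR (- g * x)) by ring.
  by rewrite ler_pM // ?phiB ?hK.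
have lip h K h2 K2 D x : half_continuous h -> 0 <= K ->
    (forall x, 0 <= x -> `|h x| <= K * expR (- g * x)) ->
    half_continuous h2 -> 0 <= K2 -> 0 <= D ->
    (forall x, 0 <= x -> `|h2 x| <= K2 * expR (- g * x)) ->
    (forall x, 0 <= x -> `|h x - h2 x| <= D * expR (- g * x)) -> 0 <= x ->
    `|G h x - G h2 x| <= M * D * expR (- g * x).
  move=> ch K0 hK ch2 K20 D0 h2K hD x0.
  have Dt := dt _ _ D0 hD; have Df := df _ _ D0 hD.
  rewrite (_ : (fun t => psi t * (h t - h2 t)) = fun t => psi t * h t - psi t * h2 t) in Dt;
    last by apply/funext => t; rewrite mulrBr.
  rewrite (_ : (fun t => phi t * (h t - h2 t)) = fun t => phi t * h t - phi t * h2 t) in Df;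
    last by apply/funext => t; rewrite mulrBr.
  have At := primitive_from_sub_le (half_continuousM cpsi ch)
    (half_continuousM cpsi ch2) (dt _ _ K0 hK) (dt _ _ K20 h2K) Dt x0.
  have Af := primitive_from_sub_le (half_continuousM cphi ch)
    (half_continuousM cphi ch2) (df _ _ K0 hK) (df _ _ K20 h2K) Df x0.
  rewrite /G.
  move: (primitive_from _ _ _) (primitive_from _ _ _) At => a' a At.
  move: (primitive_from _ _ _) (primitive_from _ _ _) Af => b' b Af.
  have -> : k * (phi x * a - psi x * b) - k * (phi x * a' - psi x * b') =
    k * (phi x * (a - a') - psi x * (b - b')) by ring.
  rewrite normrM /M -!mulrA ler_wpM2l // mulrDl.
  apply: le_trans (ler_normB _ _) _; rewrite !normrM lerD //.
    apply: le_trans (ler_pM _ _ (phiB x x0) At) _ => //.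
    have -> : - g * x = - l * x + (l - g) * x by ring.
    by rewrite expRD le_eqVlt; apply/orP; left; apply/eqP; ring.
  apply: le_trans (ler_pM _ _ (psiB x x0) Af) _ => //.
  have -> : - g * x = l * x + - (l + g) * x by ring.
  by rewrite expRD le_eqVlt; apply/orP; left; apply/eqP; ring.
exists G, M; split=> // h K ch K0 hK; split.
- exists (fun x => k * (phi' x * primitive_from true (fun t => psi t * h t) x -
                   psi' x * primitive_from false (fun t => phi t * h t) x)); split.
  + move=> x x0; have [d _] := sol x x0; have [e _] := sol2 x x0.
    have a := is_derive_primitive_from true (half_continuousM cpsi ch) x0.
    have b := is_derive_primitive_from false (half_continuousM cphi ch) x0.
    apply: is_derive_val (is_derive_cmulf k (is_derive_addf (is_derive_mulf d a)
      (is_derive_oppf (is_derive_mulf e b)))).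
    by move: (primitive_from _ _ _) (primitive_from _ _ _) => u v; ring.
  + move=> x x0; have [_ d] := sol x x0; have [_ e] := sol2 x x0.
    have a := is_derive_primitive_from true (half_continuousM cpsi ch) x0.
    have b := is_derive_primitive_from false (half_continuousM cphi ch) x0.
    apply: is_derive_val (is_derive_cmulf k (is_derive_addf (is_derive_mulf d a)
      (is_derive_oppf (is_derive_mulf e b)))).
    have W := wronskian_cst sol sol2 x0.
    rewrite psi0 psi'0 mulr0 mulr1 sub0r in W.
    rewrite /G; move: (primitive_from _ _ _) (primitive_from _ _ _) => u v.
    transitivity (q x * (k * (phi x * v - psi x * u)) -
       k * (phi x * psi' x - phi' x * psi x) * h x); first by ring.
    rewrite W /k mulrNN mulVf // mul1r //.
  + by rewrite primitive_from0 psi'0 mulr0 mul0r subr0 mulr0.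
- have G0 x : G (fun=> 0) x = 0.
    rewrite /G; under [X in primitive_from true X]eq_fun do rewrite mulr0.
    under [X in primitive_from false X]eq_fun do rewrite mulr0.
    by rewrite !primitive_from_zero !mulr0 subr0 mulr0.
  move=> x x0; rewrite -[G h x]subr0 -(G0 x).
  apply: (lip h K (fun=> 0) 0 K) => //.
  + by move=> y _; exact: cvg_cst.
  + by move=> y _; rewrite normr0 mul0r.
  + by move=> y y0; rewrite subr0 hK.
- by move=> h2 K2 D x ch2 K20 D0 h2K hD x0; apply: (lip h K h2 K2 D).
Qed.

End Equation.
End LinearTheory.

(** * The explicit homoclinic profiles *)

Section Profile.
Context {R : realType}.
Implicit Types (x y : R).

Definition cosh (m x : R) := (expR (m * x) + expR (- m * x)) / 2.
Definition sinh (m x : R) := (expR (m * x) - expR (- m * x)) / 2.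

Lemma is_derive_cosh (m : R) x : der (cosh m) x (m * sinh m x).
Proof.
apply: is_derive_ext _ (is_derive_val _ (is_derive_cmulf 2^-1
  (is_derive_addf (is_derive_expl m x) (is_derive_expl (- m) x)))).
  by move=> y; rewrite /cosh mulrC.
by rewrite /sinh; ring.
Qed.

Lemma is_derive_sinh (m : R) x : der (sinh m) x (m * cosh m x).
Proof.
apply: is_derive_ext _ (is_derive_val _ (is_derive_cmulf 2^-1
  (is_derive_addf (is_derive_expl m x) (is_derive_oppf (is_derive_expl (- m) x))))).
  by move=> y; rewrite /sinh mulrC.
by rewrite /cosh; ring.
Qed.

Lemma sinh2 (m x : R) : sinh m x ^+ 2 = cosh m x ^+ 2 - 1.
Proof.
have E : expR (m * x) * expR (- m * x) = 1 by rewrite mulNr expRxMexpNx_1.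
by rewrite -E /sinh /cosh; move: (expR _) (expR _) => a b; field.
Qed.

Lemma cosh_ge1 (m x : R) : 1 <= cosh m x.
Proof.
have h := sqr_ge0 (sinh m x); rewrite sinh2 subr_ge0 in h.
have c0 : 0 < cosh m x by rewrite divr_gt0 // addr_gt0 ?expR_gt0.
by move: h; rewrite -{1}(expr1n R 2) ler_pXn2r ?nnegrE ?ler01 // ltW.
Qed.

Lemma sinh_gt0 (m x : R) : 0 < m -> 0 < x -> 0 < sinh m x.
Proof.
move=> m0 x0; rewrite divr_gt0 // subr_gt0 ltr_expR.
by have := mulr_gt0 m0 x0; lra.
Qed.

(** The energy identity [d w'^2 = al w^2 - 2 c w^3 - w^4 / 2] shows that [p = 1 / w]
    satisfies [d p'^2 = al p^2 - 2 c p - 1 / 2], hence a linear second order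
    equation, solved by [p = (c + s b cosh (m x)) / al] with
    [b^2 = c^2 + al / 2].  As [b > |c|], it does not vanish and has the sign
    [s = 1] or [s = -1]. *)
Lemma homoclinic_profile (d al c s : R) : 0 < d -> 0 < al -> s * s = 1 ->
  exists (w w' : R -> R) (K : R), [/\ forall x, der w x (w' x),
    forall x, der w' x ((al * w x - 3 * c * w x ^+ 2 - w x ^+ 3) / d),
    forall x, 0 <= x -> `|w x| <= K * expR (- Num.sqrt (al / d) * x),
    w' 0 = 0 & (forall x, 0 < x -> 0 < - s * w' x) /\ (forall x, 0 < s * w x)].
Proof.
move=> d0 al0 ss.
set m := Num.sqrt (al / d).
have m2 : m ^+ 2 = al / d by rewrite sqr_sqrtr // divr_ge0 // ltW.
have m0 : 0 < m by rewrite sqrtr_gt0 divr_gt0.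
set b := Num.sqrt (c ^+ 2 + al / 2).
have b2 : b ^+ 2 = c ^+ 2 + al / 2.
  by rewrite sqr_sqrtr // addr_ge0 ?sqr_ge0 ?divr_ge0 ?ltW.
have bc : `|c| < b.
  rewrite -sqrtr_sqr ltr_sqrt; last by rewrite ltr_wpDl ?sqr_ge0 ?divr_gt0.
    by rewrite ltrDl divr_gt0.
have b0 : 0 < b by apply: le_lt_trans bc.
pose D x := c + s * b * cosh m x.
have s1 : `|s| = 1.
  have : `|s| ^+ 2 = 1 by rewrite -normrX expr2 ss normr1.
  by move=> /eqP; rewrite sqrp_eq1 // => /eqP.
have Dpos x : (b - `|c|) * cosh m x <= s * D x.
  have c1 := cosh_ge1 m x.
  have -> : s * D x = b * cosh m x + s * c.
    by rewrite /D mulrDr addrC mulrA mulrA ss mul1r.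
  have : - `|c| <= s * c.
    by rewrite lerNl -mulNr (le_trans (ler_norm _)) // normrM normrN s1 mul1r.
  have : `|c| <= `|c| * cosh m x by rewrite ler_peMr.
  by lra.
have bc0 : 0 < b - `|c| by rewrite subr_gt0.
have sD0 x : 0 < s * D x.
  apply: lt_le_trans (Dpos x); rewrite mulr_gt0 //.
  by apply: lt_le_trans (cosh_ge1 m x).
have D0 x : D x != 0.
  by apply/eqP => E; have := sD0 x; rewrite E mulr0 ltxx.
have D2 x : 0 < D x ^+ 2 by rewrite exprn_even_gt0 //= D0.
pose w x := al * (D x)^-1.
pose w' x := al * (- (s * b * (m * sinh m x)) / D x ^+ 2).
have dD x : der D x (s * b * (m * sinh m x)).
  apply: is_derive_val (is_derive_addf (is_derive_cstf c x)
    (is_derive_cmulf (s * b) (is_derive_cosh m x))).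
  by rewrite add0r.
have dw x : der w x (w' x).
  exact: is_derive_cmulf (is_derive_invf (D0 x) (dD x)).
exists w, w', (2 * al / (b - `|c|)); split.
- exact: dw.
- move=> x.
  have D20 : D x * D x != 0 by rewrite mulf_neq0.
  have dDD := @is_derive_invf _ (fun y => D y * D y) x _ D20
    (is_derive_mulf (dD x) (dD x)).
  have dS := is_derive_cmulf (- al * s * b * m) (is_derive_mulf (is_derive_sinh m x) dDD).
  apply: (is_derive_val _ (is_derive_ext _ dS)) => [|y]; last first.
    by rewrite /w' -expr2; ring.
  have d0' : d != 0 by rewrite gt_eqF.
  have Ec : cosh m x = s * (D x - c) / b.
    have -> : D x - c = s * b * cosh m x by rewrite /D addrC addKr.
    by move: (cosh m x) => h; rewrite !mulrA ss mul1r [RHS]mulrC mulKf // gt_eqF.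
  have Es : (s * b * sinh m x) ^+ 2 = (D x - c) ^+ 2 - b ^+ 2.
    have -> : D x - c = s * b * cosh m x by rewrite /D addrC addKr.
    have -> : (s * b * cosh m x) ^+ 2 = (s * s) * (b * cosh m x) ^+ 2 by ring.
    have -> : (s * b * sinh m x) ^+ 2 = (s * s) * b ^+ 2 * sinh m x ^+ 2 by ring.
    by rewrite ss sinh2; ring.
  have ab : al = 2 * (b ^+ 2 - c ^+ 2) by rewrite b2; field.
  (* [D'^2] is expressed through [D] by [sinh^2 = cosh^2 - 1]. *)
  transitivity (al * m ^+ 2 * (- (s * s) * (D x - c) / (D x) ^+ 2 +
      2 * (s * b * sinh m x) ^+ 2 / (D x) ^+ 3)).
    by rewrite {1}Ec; field; rewrite D0 gt_eqF.
  rewrite ss Es m2 /w; move: (D x) (D0 x) => t t0.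
  move: (b) ab => b' ->; field.
  by rewrite t0 d0'.
- move=> x x0; rewrite /w normrM gtr0_norm // normfV.
  have -> : `|D x| = s * D x.
    by rewrite -[LHS]mul1r -s1 -normrM gtr0_norm.
  have e0 := expR_gt0 (m * x).
  have -> : 2 * al / (b - `|c|) * expR (- m * x) =
     al / ((b - `|c|) * (expR (m * x) / 2)).
    by rewrite mulNr expRN; field; rewrite !gt_eqF.
  rewrite ler_wpM2l ?(ltW al0) // lef_pV2 ?posrE ?sD0 //; last first.
    by rewrite mulr_gt0 ?divr_gt0.
  apply: le_trans (Dpos x); rewrite ler_wpM2l ?(ltW bc0) // /cosh.
  rewrite ler_wpM2r ?invr_ge0 //.
  by rewrite lerDl expR_ge0.
- have s0 : sinh m 0 = 0 by rewrite /sinh mulNr mulr0 oppr0 subrr mul0r.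
  by rewrite /w' s0 !mulr0 oppr0 mul0r mulr0.
split=> x.
  move=> x0; have -> : - s * w' x = (s * s) * al * b * m * sinh m x / D x ^+ 2.
    by rewrite /w'; ring.
  rewrite ss mul1r; move: (sinh m x) (sinh_gt0 m0 x0) => h h0.
  by apply: divr_gt0; [rewrite !mulr_gt0|exact: D2].
have -> : s * w x = al * (s * D x) / D x ^+ 2 by rewrite /w; field.
by apply: divr_gt0; [rewrite mulr_gt0|exact: D2].
Qed.

End Profile.

(** * Nondegeneracy of the linearization *)

Section Nondegeneracy.
Context {R : realType}.
Implicit Types (x y : R).

(** A constant bounded by a decaying function is nonpositive: used for quantities,
    such as Wronskians, that tend to zero and are constant or monotone. *)
Lemma le0_decay (a A g : R) : 0 < g ->
  (forall x, 0 <= x -> a <= A * expR (- g * x)) -> a <= 0.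
Proof.
move=> g0 H; rewrite leNgt; apply/negP => a0.
have A0 : 0 < A.
  by have := H 0 (lexx 0); rewrite mulr0 expR0 mulr1; exact: lt_le_trans.
have x0 : 0 <= A / (a * g) by rewrite divr_ge0 ?mulr_ge0 // ltW.
have := H _ x0; apply/negP; rewrite -ltNge.
have -> : - g * (A / (a * g)) = - (A / a) by field; rewrite !gt_eqF.
rewrite expRN ltr_pdivrMr ?expR_gt0 //.
apply: lt_le_trans (ler_wpM2l (ltW a0) (expR_ge1Dx (A / a))).
by rewrite mulrDr mulr1 mulrC divfK ?gt_eqF // ltrDr.
Qed.

Variables (d zt ft c s m K : R) (w w' : R -> R).
Hypotheses (d0 : 0 < d) (ft0 : ft != 0) (m0 : 0 < m).
Hypothesis eqc : zt * c - c ^+ 3 + ft = 0.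
Let al := zt - 3 * c ^+ 2.
Let w2 x := (al * w x - 3 * c * w x ^+ 2 - w x ^+ 3) / d.
Hypothesis dw : forall x, der w x (w' x).
Hypothesis dw' : forall x, der w' x (w2 x).
Hypothesis wK : forall x, 0 <= x -> `|w x| <= K * expR (- m * x).
Hypothesis w'0 : w' 0 = 0.
Hypothesis w'_gt0 : forall x, 0 < x -> 0 < - s * w' x.

(** The coefficient of [- y] in the two blocks of the linearization: [e = 3] in the
    direction of the profile, [e = 1] in the orthogonal one. *)
Definition potential (e : R) x := (zt - e * (c + w x) ^+ 2) / d.

Let K0 : 0 <= K.
Proof.
have := le_trans (normr_ge0 _) (wK (lexx 0)).
by rewrite mulr0 expR0 mulr1.
Qed.

Let wb x : 0 <= x -> `|w x| <= K.
Proof.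
move=> x0; apply: le_trans (wK x0) _; rewrite ler_piMr // expR_le1 mulNr oppr_le0.
by rewrite mulr_ge0 // ltW.
Qed.

Let vb x : 0 <= x -> `|c + w x| <= `|c| + K.
Proof. by move=> x0; apply: le_trans (ler_normD _ _) _; rewrite lerD // wb. Qed.

Let di : 0 < d^-1. Proof. by rewrite invr_gt0. Qed.

Let Q (e : R) := (`|zt| + `|e| * (`|c| + K) ^+ 2) / d.

Let potential_le e x : 0 <= x -> `|potential e x| <= Q e.
Proof.
move=> x0; rewrite /potential /Q normrM (gtr0_norm di).
rewrite ler_wpM2r ?invr_ge0 ?(ltW d0) //.
apply: le_trans (ler_normB _ _) _; rewrite lerD // normrM ler_wpM2l // normrX.
by rewrite ler_pXn2r ?nnegrE ?addr_ge0 // vb.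
Qed.

Let solves_decay e phi phi' l B : 0 < l -> solves (potential e) phi phi' ->
  (forall x, 0 <= x -> `|phi x| <= B * expR (- l * x)) ->
  forall x, 0 <= x -> `|phi' x| <= (B + B + Q e * B) * expR (- l * x).
Proof.
move=> l0 sol phiB; apply: (@derive_decay _ phi phi' (fun x => potential e x * phi x)) => //.
- by move=> x x0; have [] := sol x x0.
- by move=> x x0; have [] := sol x x0.
move=> x x0; rewrite normrM -mulrA ler_pM //; first exact: potential_le.
exact: phiB.
Qed.

Let solves_w' : solves (potential 3) w' w2.
Proof.
move=> x _; split; first exact: dw'.
have A := is_derive_mulf (dw x) (dw x); have B := is_derive_mulf A (dw x).
have D := is_derive_cmulf d^-1 (is_derive_addf (is_derive_addf
  (is_derive_cmulf al (dw x)) (is_derive_cmulf (- 3 * c) A)) (is_derive_oppf B)).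
apply: (is_derive_val _ (is_derive_ext _ D)) => [|y]; last by rewrite /w2; ring.
by rewrite /potential /al; ring.
Qed.

Let K2 := (`|al| + 3 * `|c| * K + K ^+ 2) / d * K.

Let w2_le x : 0 <= x -> `|w2 x| <= K2 * expR (- m * x).
Proof.
move=> x0; have -> : w2 x = (al - 3 * c * w x - w x ^+ 2) / d * w x by rewrite /w2; ring.
rewrite normrM /K2 -[leRHS]mulrA ler_pM //; last exact: wK.
rewrite normrM (gtr0_norm di) ler_wpM2r ?invr_ge0 ?(ltW d0) //.
have h3 : `|3 : R| = 3 by rewrite ger0_norm.
apply: le_trans (ler_normB _ _) _; apply: lerD; last first.
  by rewrite normrX ler_pXn2r ?nnegrE // wb.
apply: le_trans (ler_normB _ _) _; apply: lerD => //.
by rewrite !normrM h3 ler_wpM2l ?mulr_ge0 // wb.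
Qed.

Let K1 := K + K + K2.

Let w'_le x : 0 <= x -> `|w' x| <= K1 * expR (- m * x).
Proof. by move=> x0; apply: (@derive_decay _ w w' w2). Qed.

Let bounded_of_decay (A : R) (f : R -> R) x : 0 <= x ->
  `|f x| <= A * expR (- m * x) -> `|f x| <= A.
Proof.
move=> x0 h; apply: le_trans (h) _.
have A0 : 0 <= A by have := le_trans (normr_ge0 _) h; rewrite pmulr_lge0 ?expR_gt0.
by rewrite ler_piMr // expR_le1 mulNr oppr_le0 mulr_ge0 // ltW.
Qed.

Let wronskian_le (l B B1 P P1 : R) (phi phi' psi psi' : R -> R) x : 0 <= x ->
  `|phi x| <= B * expR (- l * x) -> `|phi' x| <= B1 * expR (- l * x) ->
  `|psi x| <= P -> `|psi' x| <= P1 ->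
  `|phi x * psi' x - phi' x * psi x| <= (B * P1 + B1 * P) * expR (- l * x).
Proof.
move=> x0 h1 h2 h3 h4; apply: le_trans (ler_normB _ _) _; rewrite !normrM mulrDl.
by rewrite ![_ * expR _]mulrAC lerD // ler_pM.
Qed.

(** By translation invariance [w'] solves the linearized equation; it decays and
    vanishes at the origin.  Another decaying solution has zero Wronskian with
    it, so it vanishes at the origin too. *)
Lemma slope_neq0_tangential phi phi' l B X : 0 < l -> 0 <= X ->
  solves (potential 3) phi phi' ->
  (forall x, 0 <= x -> `|phi x| <= B * expR (- l * x)) ->
  (forall x, X <= x -> 0 < phi x) -> phi' 0 != 0.
Proof.
move=> l0 X0 sol phiB phi_gt0; apply/eqP => p0.
have phi'B := solves_decay l0 sol phiB.
have W x : 0 <= x -> phi 0 * w2 0 = phi x * w2 x - phi' x * w' x.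
  by move=> x0; rewrite (wronskian_cst sol solves_w' x0) w'0 mulr0 subr0.
have : `|phi 0 * w2 0| <= 0.
  apply: (@le0_decay _ (B * K2 + (B + B + Q 3 * B) * K1) l) => // x x0.
  rewrite (W x x0); apply: wronskian_le => //.
  - exact: phiB.
  - exact: phi'B.
  - exact: bounded_of_decay (w'_le x0).
  - exact: bounded_of_decay (w2_le x0).
rewrite normr_le0 mulf_eq0 => /orP[] /eqP z.
  have := phi_gt0 X (lexx X).
  rewrite (solves_zero sol _ (@potential_le 3) z p0) ?ltxx //.
  exact: le_trans (potential_le 3 (lexx 0)).
have := w'_gt0 ltr01.
rewrite (solves_zero solves_w' _ (@potential_le 3) w'0 z) ?mulr0 ?ltxx //.
exact: le_trans (potential_le 3 (lexx 0)).
Qed.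

(** Sturm comparison with [- s w'], a positive solution for a smaller potential:
    past its last zero, an eventually positive decaying solution would have a nondecreasing
    Wronskian with it that starts nonnegative and tends to zero. *)
Lemma decaying_gt0 phi phi' l B X : 0 < l -> 0 <= X ->
  solves (potential 1) phi phi' ->
  (forall x, 0 <= x -> `|phi x| <= B * expR (- l * x)) ->
  (forall x, X <= x -> 0 < phi x) -> forall x, 0 <= x -> 0 < phi x.
Proof.
move=> l0 X0 sol phiB phi_gt0 x1 x10; rewrite ltNge; apply/negP => phix1.
have cphi := solves_continuous sol.
have phi'B := solves_decay l0 sol phiB.
(* [z] is the last zero of [phi]. *)
pose S := [set x | 0 <= x /\ phi x <= 0].
have SX x : S x -> x <= X.
  by move=> [x0 px]; rewrite leNgt; apply/negP => /ltW/phi_gt0; rewrite ltNge px.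
have hS : has_sup S by split; [exists x1|exists X => x; exact: SX].
pose z := sup S.
have Sx1 : S x1 by split.
have z0 : 0 <= z.
  apply: le_trans x10 _. exact: (sup_upper_bound hS).
have gt x : z < x -> 0 < phi x.
  move=> zx; rewrite ltNge; apply/negP => px.
  have : x <= z by apply: (sup_upper_bound hS); split=> //; apply: le_trans z0 (ltW zx).
  by rewrite leNgt zx.
have cz : {for z, continuous phi} by exact: cphi.
have phiz_ge : 0 <= phi z.
  rewrite leNgt; apply/negP => pz.
  have e0 : 0 < - phi z / 2 by rewrite divr_gt0 // oppr_gt0.
  have /cvgrPdist_le/(_ _ e0)[r /= r0 H] := cz.
  have zr : z < z + r / 2 by lra.
  have h : `|phi z - phi (z + r / 2)| <= - phi z / 2.
    apply: H; rewrite /ball_ /=.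
    have -> : z - (z + r / 2) = - (r / 2) by ring.
    by rewrite normrN gtr0_norm; lra.
  by have := gt _ zr; move: h; rewrite ler_norml => /andP[]; lra.
have phiz_le : phi z <= 0.
  rewrite leNgt; apply/negP => pz.
  have e0 : 0 < phi z / 2 by rewrite divr_gt0.
  have /cvgrPdist_le/(_ _ e0)[r /= r0 H] := cz.
  have [y Sy zy] := sup_adherent r0 hS.
  have yz : y <= z by apply: (sup_upper_bound hS).
  have h : `|phi z - phi y| <= phi z / 2.
    by apply: H; rewrite /ball_ /= ger0_norm ?subr_ge0 //; rewrite -/z in zy; lra.
  by move: h; rewrite ler_norml => /andP[]; case: Sy => _; lra.
have phiz : phi z = 0 by apply/eqP; rewrite eq_le phiz_le phiz_ge.
have phi'z : 0 <= phi' z.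
  rewrite leNgt; apply/negP => pz.
  have e0 : 0 < - phi' z / 2 by rewrite divr_gt0 // oppr_gt0.
  have [/is_deriveP/(_ _ e0)[r r0 H] _] := sol z z0.
  have r20 : 0 < r / 2 by rewrite divr_gt0.
  have h : `|phi' z - (r / 2)^-1 * (phi (r / 2 + z) - phi z)| <= - phi' z / 2.
    by apply: H; [rewrite gtr0_norm //; lra|rewrite gt_eqF].
  have zr : z < r / 2 + z by lra.
  have : 0 < (r / 2)^-1 * phi (r / 2 + z) by rewrite mulr_gt0 ?invr_gt0 // gt.
  by move: h; rewrite phiz subr0 ler_norml => /andP[]; lra.
pose psi x := - s * w' x; pose psi' x := - s * w2 x.
have psi_ge0 x : 0 <= x -> 0 <= psi x.
  by rewrite le_eqVlt => /orP[/eqP<-|/w'_gt0/ltW//]; rewrite /psi w'0 mulr0.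
pose W x := - (phi x * psi' x - phi' x * psi x).
pose W' x := 2 * (c + w x) ^+ 2 / d * (phi x * psi x).
have dW x : z <= x -> der W x (W' x).
  move=> zx; have x0 := le_trans z0 zx; have [d1 d2] := sol x x0.
  have [d3 d4] := solves_w' x0.
  apply: is_derive_val (is_derive_oppf (is_derive_addf
    (is_derive_mulf d1 (is_derive_cmulf (- s) d4))
    (is_derive_oppf (is_derive_mulf d2 (is_derive_cmulf (- s) d3))))).
  by rewrite /W' /psi /psi' /potential; ring.
have W'0 x : z <= x -> 0 <= W' x.
  move=> zx; rewrite mulr_ge0 //.
    by apply: divr_ge0; [rewrite mulr_ge0 ?sqr_ge0|exact: ltW].
  rewrite mulr_ge0 ?psi_ge0 ?(le_trans z0 zx) //.
  by move: zx; rewrite le_eqVlt => /orP[/eqP<-|/gt/ltW//]; rewrite phiz.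
have Wz : 0 <= W z.
  by rewrite /W phiz mul0r sub0r opprK mulr_ge0 // psi_ge0.
have W_ge0 x : z <= x -> 0 <= W x.
  by move=> zx; apply: le_trans Wz _; apply: (ge0_derive_le dW W'0).
have W_le0 x : z <= x -> W x <= 0.
  move=> zx; have x0 := le_trans z0 zx.
  pose A := B * (`|s| * K2) + (B + B + Q 1 * B) * (`|s| * K1).
  apply: (@le0_decay _ (A * expR (- l * x)) l) => // y y0.
  have xy0 : 0 <= x + y by rewrite addr_ge0.
  have -> : A * expR (- l * x) * expR (- l * y) = A * expR (- l * (x + y)).
    by rewrite mulrDr expRD mulrA.
  apply: (@le_trans _ _ (W (x + y))).
    by apply: (ge0_derive_le dW W'0) => //; rewrite lerDl.
  apply: le_trans (ler_norm _) _; rewrite normrN; apply: wronskian_le => //.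
  - exact: phiB.
  - exact: phi'B.
  - by rewrite normrM normrN ler_wpM2l //; exact: bounded_of_decay (w'_le xy0).
  - by rewrite normrM normrN ler_wpM2l //; exact: bounded_of_decay (w2_le xy0).
(* [W = 0] past [z], so that [W' = 0]: [c + w] would have two zeros there, and
   [w'] a zero between them. *)
have zero a : z < a -> exists2 b, a < b < a + 1 & c + w b = 0.
  move=> za; have aa : a < a + 1 by rewrite ltrDl.
  have [b [ab ba E]] := mean_value dW (ltW za) aa.
  exists b; first by rewrite ab.
  have W0 x : z <= x -> W x = 0.
    by move=> zx; apply/eqP; rewrite eq_le W_ge0 // W_le0.
  have zb := lt_trans za ab.
  move/eqP: E; rewrite !W0 ?(ltW za) ?(ltW (lt_trans za aa)) // subr0 eq_sym.
  have phib := gt b zb; have psib : 0 < psi b by apply: w'_gt0; exact: le_lt_trans zb.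
  have phipsi := mulr_gt0 phib psib.
  rewrite addrAC subrr add0r mulr1 /W'.
  move: (phi b * psi b) phipsi => t t0.
  rewrite !mulf_eq0 invr_eq0 (gt_eqF d0) (gt_eqF t0) !orbF.
  by rewrite pnatr_eq0 /= orbb => /eqP.
have z1 : z < z + 1 by rewrite ltrDl.
have [b1 /andP[b11 b12] w1] := zero _ z1.
have z2 : z < z + 2 by rewrite ltrDl.
have [b2 /andP[b21 b22] w2'] := zero _ z2.
have b1b2 : b1 < b2 by lra.
have b10 : 0 <= b1 by lra.
have [b [bb1 bb2 E]] := mean_value (fun x _ => dw x) b10 b1b2.
have b0 : 0 < b by lra.
have /eqP := E; have -> : w b2 - w b1 = 0 by lra.
rewrite eq_sym mulf_eq0 [_ - b1 == 0]gt_eqF ?subr_gt0 // orbF => /eqP w'b.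
by have := w'_gt0 b0; rewrite w'b mulr0 ltxx.
Qed.

(** Green's identity with [c + w], which this block maps to the constant [- ft]: up
    to a nonzero factor, the slope at the origin is the integral of [phi].  The
    argument is that [W] is then strictly monotone, and tends to zero. *)
Lemma slope_neq0_transversal phi phi' l B X : 0 < l -> 0 <= X ->
  solves (potential 1) phi phi' ->
  (forall x, 0 <= x -> `|phi x| <= B * expR (- l * x)) ->
  (forall x, X <= x -> 0 < phi x) -> phi' 0 != 0.
Proof.
move=> l0 X0 sol phiB phi_pos; apply/eqP => p0.
have phi_gt0 := decaying_gt0 l0 X0 sol phiB phi_pos.
have phi'B := solves_decay l0 sol phiB.
pose W x := ft * (phi x * w' x - phi' x * (c + w x)).
pose W' x := ft ^+ 2 / d * phi x.
have dW x : 0 <= x -> der W x (W' x).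
  move=> x0; have [d1 d2] := sol x x0.
  apply: is_derive_val (is_derive_cmulf ft (is_derive_addf
    (is_derive_mulf d1 (dw' x))
    (is_derive_oppf (is_derive_mulf d2 (is_derive_addf (is_derive_cstf c x) (dw x)))))).
  have E : ft = c ^+ 3 - zt * c by have := eqc; lra.
  by rewrite /W' /w2 /potential /al E; ring.
have f2 : 0 < ft ^+ 2 / d by rewrite divr_gt0 // exprn_even_gt0.
have W'0 x : 0 <= x -> 0 <= W' x.
  by move=> x0; apply: mulr_ge0; rewrite ltW // phi_gt0.
have W0 : W 0 = 0 by rewrite /W w'0 p0 mulr0 mul0r subr0 mulr0.
have W1 : 0 < W 1.
  have [b [b0 b1 E]] := mean_value dW (lexx 0) ltr01.
  have -> : W 1 = W' b * (1 - 0) by rewrite -E W0 subr0.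
  by rewrite subr0 mulr1; apply: mulr_gt0 => //; apply: phi_gt0; exact: ltW.
suff : W 1 <= 0 by rewrite leNgt W1.
pose A := `|ft| * (B * K1 + (B + B + Q 1 * B) * (`|c| + K)).
apply: (@le0_decay _ (A * expR (- l * 1)) l) => // y y0.
have y1 : 0 <= 1 + y by rewrite addr_ge0.
have -> : A * expR (- l * 1) * expR (- l * y) = A * expR (- l * (1 + y)).
  by rewrite mulrDr expRD mulrA.
apply: (@le_trans _ _ (W (1 + y))).
  by apply: (ge0_derive_le dW W'0) => //; rewrite lerDl.
have h := @wronskian_le l B (B + B + Q 1 * B) (`|c| + K) K1 phi phi'
  (fun x => c + w x) w' (1 + y) y1 (phiB _ y1) (phi'B _ y1) (vb y1)
  (bounded_of_decay y1 (w'_le y1)).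
apply: le_trans (ler_norm _) _; rewrite /W normrM.
by apply: le_trans (ler_wpM2l (normr_ge0 ft) h) _; rewrite /A mulrA.
Qed.

(** Both blocks have the limit [(zt - e c^2) / d > 0] at infinity, approached
    exponentially, so that the theory above applies to them. *)
Lemma linearization_inverse (e g : R) : 0 < zt - e * c ^+ 2 ->
  0 < g -> g < Num.sqrt ((zt - e * c ^+ 2) / d) -> e = 1 \/ e = 3 ->
  exists G M, neumann_inverse (potential e) g G M.
Proof.
move=> e0 g0; set l := Num.sqrt _ => gl e13.
have l0 : 0 < l by apply: lt_trans gl.
have l2 : l ^+ 2 = (zt - e * c ^+ 2) / d by rewrite sqr_sqrtr // divr_ge0 // ltW.
pose V x := - e * (2 * c + w x) / d * w x.
have qE : potential e = (fun x => l ^+ 2 + V x).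
  by apply/funext => x; rewrite l2 /potential /V; ring.
have cV : half_continuous V.
  move=> x x0.
  apply: is_derive_cont (is_derive_mulf (is_derive_mulf (is_derive_cmulf (- e)
    (is_derive_addf (is_derive_cstf (2 * c) x) (dw x))) (is_derive_cstf d^-1 x)) (dw x)).
pose C := `|- e| * (`|2 * c| + K) / d * K.
have C0 : 0 <= C by rewrite !mulr_ge0 ?invr_ge0 ?addr_ge0 // ltW.
have VC x : 0 <= x -> `|V x| <= C * expR (- m * x).
  move=> x0; rewrite /V /C normrM -[leRHS]mulrA; apply: ler_pM => //; last exact: wK.
  rewrite normrM (gtr0_norm di); apply: ler_wpM2r; first exact: ltW.
  rewrite normrM; apply: ler_wpM2l => //.
  by apply: le_trans (ler_normD _ _) _; rewrite lerD // wb.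
have [phi [phi' [B [X [sol B0 X0 phiB phi_gt0]]]]] := jost_solution l0 m0 C0 cV VC.
have := green_operator l0 m0 C0 cV VC g0 gl sol B0 phiB; rewrite -qE; apply.
rewrite -qE in sol; case: e13 => e13; rewrite e13 in sol.
  exact: slope_neq0_transversal l0 X0 sol phiB phi_gt0.
exact: slope_neq0_tangential l0 X0 sol phiB phi_gt0.
Qed.

Lemma profile_second_decay : exists A, forall x, 0 <= x ->
  `|w2 x| <= A * expR (- m * x).
Proof. by exists K2; exact: w2_le. Qed.

End Nondegeneracy.

(** * The nonlinear remainder and the constant states *)

Section Nonlinearity.
Context {R : realType}.
Implicit Types (e k v a b V eta x y : R) (i : bool).

(** With [X = v + a] and [Y = b], the terms of the rescaled equation that are not
    linear in [(a, b)], or that carry a small parameter [e] (for [eps]) or [k] (for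
    [kappa]); [i = true] is the equation for [X], [i = false] the one for [Y]. *)
Definition remainder i e k v a b : R :=
  let N := (v + a) ^+ 2 + b ^+ 2 in
  if i then 3 * v * a ^+ 2 + a ^+ 3 + b ^+ 2 * v + b ^+ 2 * a - e * b - k * N * b
  else 2 * v * a * b + a ^+ 2 * b + b ^+ 3 + e * (v + a) + k * N * (v + a).

Let nM (x y p q : R) : `|x| <= p -> `|y| <= q -> `|x * y| <= p * q.
Proof. by move=> xp yq; rewrite normrM ler_pM. Qed.

Let nD (x y p q : R) : `|x| <= p -> `|y| <= q -> `|x + y| <= p + q.
Proof. by move=> xp yq; apply: le_trans (ler_normD _ _) _; rewrite lerD. Qed.

Let nN (x p : R) : `|x| <= p -> `|- x| <= p.
Proof. by rewrite normrN. Qed.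

Let nn n : `|n%:R : R| <= n%:R.
Proof. by rewrite normr_nat. Qed.

(** Every term of the remainder is quadratic in [(a, b)] or carries [e] or [k], so
    that one small factor survives in each difference. *)
Lemma remainder_lipschitz i V eta e k v a b v' a' b' : 1 <= V -> eta <= 1 ->
  `|e| <= eta -> `|k| <= eta -> `|v| <= V -> `|v'| <= V ->
  `|a| <= eta -> `|b| <= eta -> `|a'| <= eta -> `|b'| <= eta ->
  `|remainder i e k v a b - remainder i e k v' a' b'| <=
    20 * V ^+ 2 * eta * (`|v - v'| + `|a - a'| + `|b - b'|).
Proof.
move=> V1 e1 he hk hv hv' ha hb ha' hb'.
have eta0 : 0 <= eta by apply: le_trans he.
have ha1 := le_trans ha e1; have hb1 := le_trans hb e1.
have ha1' := le_trans ha' e1; have hb1' := le_trans hb' e1.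
have VV : V <= V ^+ 2 by rewrite expr2 ler_peMl // (le_trans ler01).
have eV : eta <= eta * V by rewrite ler_peMr.
have eVV : eta * V <= eta * V ^+ 2 by rewrite ler_wpM2l.
pose s := v + a + v' + a'.
have hs : `|s| <= 4 * V.
  apply: le_trans (nD (nD (nD hv ha1) hv') ha1') _; lra.
pose N' := (v' + a') ^+ 2 + b' ^+ 2.
have hva : `|v + a| <= 2 * V by apply: le_trans (nD hv ha1) _; lra.
have hva' : `|v' + a'| <= 2 * V by apply: le_trans (nD hv' ha1') _; lra.
have hN' : `|N'| <= 5 * V ^+ 2.
  apply: le_trans (nD (nM hva' hva') (nM hb1' hb1')) _.
  by rewrite [V ^+ 2]expr2 in VV *; lra.
have split3 A B D z : `|A| <= 20 * V ^+ 2 * eta -> `|B| <= 20 * V ^+ 2 * eta ->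
    `|D| <= 20 * V ^+ 2 * eta -> z = (v - v') * A + (a - a') * B + (b - b') * D ->
    `|z| <= 20 * V ^+ 2 * eta * (`|v - v'| + `|a - a'| + `|b - b'|).
  move=> hA hB hD ->.
  have h := nD (nD (nM (lexx `|v - v'|) hA) (nM (lexx `|a - a'|) hB))
    (nM (lexx `|b - b'|) hD).
  by apply: le_trans h _; rewrite -!mulrDl mulrC.
have hNb : `|k * (s * b)| <= eta * (4 * V) by have := nM hk (nM hs hb1); lra.
case: i; rewrite /remainder.
  apply: (split3 (3 * (a * a) + b * b + - (k * (s * b)))
    (3 * (v' * (a + a')) + (a * a + a * a' + a' * a') + b' * b' + - (k * (s * b)))
    (v' * (b + b') + (b + b') * a + - e + - (k * ((b + b') * b + N')))).
  - have := nD (nD (nM (nn 3) (nM ha ha1)) (nM hb hb1)) (nN hNb).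
    by lra.
  - have := nD (nD (nD (nM (nn 3) (nM hv' (nD ha ha')))
      (nD (nD (nM ha ha1) (nM ha ha1')) (nM ha' ha1'))) (nM hb' hb1')) (nN hNb).
    by lra.
  - have := nD (nD (nD (nM hv' (nD hb hb')) (nM (nD hb hb') ha1)) (nN he))
      (nN (nM hk (nD (nM (nD hb1 hb1') hb1) hN'))).
    by lra.
  by rewrite /s /N'; ring.
pose P := s * (v + a) + N'.
have hP : `|P| <= 13 * V ^+ 2.
  by apply: le_trans (nD (nM hs hva) hN') _; rewrite [V ^+ 2]expr2; lra.
have hkP := nM hk hP.
apply: (split3 (2 * (a * b) + e + k * P)
  (2 * (v' * b) + (a + a') * b + e + k * P)
  (2 * (v' * a') + a' * a' + (b * b + b * b' + b' * b') + k * ((b + b') * (v + a)))).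
- by have := nD (nD (nM (nn 2) (nM ha hb1)) he) hkP; lra.
- by have := nD (nD (nD (nM (nn 2) (nM hv' hb)) (nM (nD ha ha') hb1)) he) hkP; lra.
- have := nD (nD (nD (nM (nn 2) (nM hv' ha')) (nM ha' ha1'))
    (nD (nD (nM hb hb1) (nM hb hb1')) (nM hb' hb1')))
    (nM hk (nM (nD hb1 hb1') hva)).
  by lra.
by rewrite /P /s /N'; ring.
Qed.

Lemma remainder0_le i V eta e k v : 1 <= V -> `|e| <= eta -> `|k| <= eta ->
  `|v| <= V -> `|remainder i e k v 0 0| <= 2 * V ^+ 3 * eta.
Proof.
move=> V1 he hk hv; have eta0 : 0 <= eta by apply: le_trans he.
case: i; rewrite /remainder.
  have -> : 3 * v * 0 ^+ 2 + 0 ^+ 3 + 0 ^+ 2 * v + 0 ^+ 2 * 0 - e * 0 -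
    k * ((v + 0) ^+ 2 + 0 ^+ 2) * 0 = 0 by ring.
  rewrite normr0; apply: mulr_ge0 => //; apply: mulr_ge0 => //.
  by apply: exprn_ge0; apply: le_trans V1.
have -> : 2 * v * 0 * 0 + 0 ^+ 2 * 0 + 0 ^+ 3 + e * (v + 0) +
   k * ((v + 0) ^+ 2 + 0 ^+ 2) * (v + 0) = e * v + k * (v * (v * v)) by ring.
apply: le_trans (nD (nM he hv) (nM hk (nM hv (nM hv hv)))) _.
have V2 : V <= V ^+ 3.
  rewrite -[leLHS]mulr1 exprS ler_wpM2l ?(le_trans ler01) //.
  by rewrite exprn_ege1.
have : eta * V <= eta * V ^+ 3 by rewrite ler_wpM2l.
have -> : V * (V * V) = V ^+ 3 by ring.
lra.
Qed.

(** The value of [e] in [potential] for the block [i]. *)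
Definition block_coef i : R := if i then 3 else 1.

(** The implicit function theorem at the nondegenerate constant state [c], by the
    contraction argument over the two components. *)
Lemma equilibrium (zt c : R) : 0 < zt - 3 * c ^+ 2 -> forall delta : R, 0 < delta ->
  exists2 delta0 : R, 0 < delta0 & forall e k, `|e| <= delta0 -> `|k| <= delta0 ->
  exists u : bool -> R, (forall i, `|u i| <= delta) /\
    forall i, (zt - block_coef i * c ^+ 2) * u i = remainder i e k c (u true) (u false).
Proof.
move=> al0 delta' delta'0.
have den i : zt - 3 * c ^+ 2 <= zt - block_coef i * c ^+ 2.
  by have := sqr_ge0 c; case: i; rewrite /block_coef; lra.
pose al := zt - 3 * c ^+ 2.
pose V := 1 + `|c|.
have V1 : 1 <= V by rewrite lerDl.
have cV : `|c| <= V by rewrite lerDr.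
pose C := 20 * V ^+ 2.
have C0 : 0 < C by rewrite mulr_gt0 // exprn_gt0 // (lt_le_trans ltr01).
have C4 : 0 < 4 * C by exact: mulr_gt0.
(* [4 * C * delta <= al] makes the map a [1 / 2]-contraction of the ball of radius
   [delta]. *)
pose delta := Num.min (Num.min 1 delta') (al / (4 * C)).
have delta0 : 0 < delta.
  by rewrite !lt_min ltr01 delta'0 divr_gt0.
have dC : C * delta / al <= 4^-1.
  have : delta <= al / (4 * C) by rewrite ge_min lexx orbT.
  rewrite ler_pdivlMr // => h.
  by rewrite ler_pdivrMr //; lra.
have d1 : delta <= 1 by rewrite !ge_min lexx.
have d' : delta <= delta' by rewrite !ge_min lexx orbT.
pose D := 2 * V ^+ 3.
have D0 : 0 < D by rewrite mulr_gt0 // exprn_gt0 // (lt_le_trans ltr01).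
exists (Num.min delta (al * delta / (2 * D))).
  by rewrite lt_min delta0 divr_gt0 // mulr_gt0.
move=> e k; rewrite le_min => /andP[ed eD]; rewrite le_min => /andP[kd kD].
pose T (u : bool -> R) i :=
  remainder i e k c (u true) (u false) / (zt - block_coef i * c ^+ 2).
have deni i : 0 < zt - block_coef i * c ^+ 2 by apply: lt_le_trans (den i).
have quot i z : `|z / (zt - block_coef i * c ^+ 2)| <= `|z| / al.
  rewrite normrM ler_wpM2l // gtr0_norm ?invr_gt0 // lef_pV2 ?posrE //.
have T0 i : `|T (fun=> 0) i| <= delta / 2.
  apply: le_trans (quot _ _) _; rewrite ler_pdivrMr //.
  apply: le_trans (remainder0_le i V1 eD kD cV) _.
  by rewrite le_eqVlt; apply/orP; left; apply/eqP; rewrite /D; field; rewrite gt_eqF // (lt_le_trans ltr01).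
have lip (u u' : bool -> R) z : (forall i, `|u i| <= delta * 1) ->
    (forall i, `|u' i| <= delta * 1) ->
    0 <= z -> (forall i, `|u i - u' i| <= z * 1) -> forall i, `|T u i - T u' i| <= z / 2 * 1.
  move=> hu hv z0 uv i; rewrite mulr1 /T -mulrBl; apply: le_trans (quot _ _) _.
  rewrite ler_pdivrMr //.
  have hu1 j : `|u j| <= delta by have := hu j; rewrite mulr1.
  have hv1 j : `|u' j| <= delta by have := hv j; rewrite mulr1.
  have := uv true; have := uv false; rewrite !mulr1 => h1 h2.
  apply: le_trans (remainder_lipschitz i V1 d1 ed kd cV cV (hu1 true) (hu1 false)
    (hv1 true) (hv1 false)) _.
  rewrite subrr normr0 add0r -/C.
  apply: (@le_trans _ _ (C * delta * (z + z))).
    by rewrite ler_wpM2l ?lerD // mulr_ge0 // ltW.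
  move: dC; rewrite ler_pdivrMr // => dC.
  have := ler_wpM2r z0 dC; lra.
have [|||||u [_ uB uT]] := @weighted_fixed_point R bool (fun=> 1) (fun=> True) T delta _ (ltW delta0).
- by [].
- by [].
- move=> u _ hu; split=> // i; rewrite mulr1.
  have z0 (j : bool) : `|0 : R| <= delta * 1 by rewrite normr0 mulr1 ltW.
  have uz (j : bool) : `|u j - 0| <= delta * 1 by rewrite subr0.
  have h := lip u (fun=> 0) delta hu z0 (ltW delta0) uz i; rewrite mulr1 in h.
  rewrite -[T u i](subrK (T (fun=> 0) i)); apply: le_trans (ler_normD _ _) _.
  by rewrite [leRHS]splitr lerD // T0.
- by move=> u u' z _ _; exact: lip.
- by [].
exists u; split=> [i|i]; first by apply: le_trans d'; have := uB i; rewrite mulr1.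
by rewrite -{1}(uT i) /T mulrC divfK // gt_eqF.
Qed.

End Nonlinearity.

(** * Persistence of the profile *)

Section Perturbation.
Context {R : realType}.
Implicit Types (x y : R) (i : bool).

Lemma half_continuous_remainder i (e k : R) (v a b : R -> R) : half_continuous v ->
  half_continuous a -> half_continuous b ->
  half_continuous (fun x => remainder i e k (v x) (a x) (b x)).
Proof.
move=> cv ca cb; case: i; rewrite /remainder; repeat lazymatch goal with
  | |- half_continuous (fun x => @?f x - @?g x) => apply: half_continuousB
  | |- half_continuous (fun x => @?f x + @?g x) => apply: half_continuousD
  | |- half_continuous (fun x => @?f x * @?g x) => apply: half_continuousM
  | |- half_continuous (fun x => @?f x ^+ ?n) => apply: half_continuousX
  | |- half_continuous v => exact: cv
  | |- half_continuous a => exact: ca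
  | |- half_continuous b => exact: cb
  | |- half_continuous (fun x => ?f x) => change (half_continuous f)
  | |- half_continuous (fun=> _) => exact: half_continuous_cst
  end.
Qed.

Variables (d zt c K g : R) (w : R -> R) (G : bool -> (R -> R) -> R -> R) (M : bool -> R).
Hypotheses (d0 : 0 < d) (g0 : 0 < g) (cw : half_continuous w).
Hypothesis wK : forall x, 0 <= x -> `|w x| <= K * expR (- g * x).
Hypothesis GM : forall i, neumann_inverse (potential d zt c w (block_coef i)) g (G i) (M i).

(** The right-hand side for the correction [u] to the profile [c + w], once the
    correction [ai] of the equilibrium is subtracted. *)
Definition source e k (ai : bool -> R) (u : bool * R -> R) i x :=
  (remainder i e k (c + w x) (ai true + u (true, x)) (ai false + u (false, x)) -
   remainder i e k c (ai true) (ai false) +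
   block_coef i * ((c + w x) ^+ 2 - c ^+ 2) * ai i) / d.

Let K0 : 0 <= K.
Proof.
have := le_trans (normr_ge0 _) (wK (lexx 0)).
by rewrite mulr0 expR0 mulr1.
Qed.

Let e1 x : 0 <= x -> expR (- g * x) <= 1.
Proof. by move=> x0; rewrite expR_le1 mulNr oppr_le0 mulr_ge0 // ltW. Qed.

Let wb x : 0 <= x -> `|w x| <= K.
Proof. by move=> x0; apply: le_trans (wK x0) _; rewrite ler_piMr // e1. Qed.

Let V := 1 + `|c| + K.
Let V1 : 1 <= V. Proof. by rewrite /V -addrA lerDl addr_ge0. Qed.
Let cV : `|c| <= V. Proof. by have := K0; rewrite /V; lra. Qed.
Let vV x : 0 <= x -> `|c + w x| <= V.
Proof.
move=> x0; apply: le_trans (ler_normD _ _) _; have := wb x0; rewrite /V; lra.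
Qed.

Let C := 20 * V ^+ 2.
Let C0 : 0 < C.
Proof. by apply: mulr_gt0 => //; apply: exprn_gt0; apply: lt_le_trans V1. Qed.

Let Mm := 1 + M true + M false.
Let M0 i : 0 <= M i. Proof. by have [] := GM i. Qed.
Let MMm i : M i <= Mm.
Proof. by have := M0 true; have := M0 false; rewrite /Mm; case: i; lra. Qed.
Let Mm0 : 0 < Mm. Proof. by have := M0 true; have := M0 false; rewrite /Mm; lra. Qed.

Let source_lip e k ai (u u' : bool * R -> R) eta eta2 z i x : eta + eta2 <= 1 ->
  0 <= eta -> 0 <= eta2 ->
  `|e| <= eta -> `|k| <= eta -> (forall i, `|ai i| <= eta) -> 0 <= x ->
  (forall i, `|u (i, x)| <= eta2) -> (forall i, `|u' (i, x)| <= eta2) ->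
  (forall i, `|u (i, x) - u' (i, x)| <= z * expR (- g * x)) ->
  `|source e k ai u i x - source e k ai u' i x| <=
    C * (eta + eta2) * (2 * z) / d * expR (- g * x).
Proof.
move=> h1 h0 h2 he hk ha x0 hu hu' uv.
have hh : eta <= eta + eta2 by rewrite lerDl.
have A (j : bool) : `|ai j + u (j, x)| <= eta + eta2.
  by apply: le_trans (ler_normD _ _) _; rewrite lerD.
have A' (j : bool) : `|ai j + u' (j, x)| <= eta + eta2.
  by apply: le_trans (ler_normD _ _) _; rewrite lerD.
have E (a b p q : R) : (a - p + q) / d - (b - p + q) / d = (a - b) / d by ring.
rewrite /source E normrM [`|d^-1|]gtr0_norm ?invr_gt0 // [leRHS]mulrAC.
rewrite ler_wpM2r ?invr_ge0 ?(ltW d0) //.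
apply: le_trans (remainder_lipschitz i V1 h1 (le_trans he hh) (le_trans hk hh)
  (vV x0) (vV x0) (A true) (A false) (A' true) (A' false)) _.
rewrite -/C -[leRHS]mulrA ler_wpM2l ?mulr_ge0 ?addr_ge0 ?(ltW C0) //.
have S (a p q : R) : (a + p) - (a + q) = p - q by ring.
rewrite subrr normr0 add0r !S.
by have := uv true; have := uv false; lra.
Qed.

Let source0 e k ai eta i x : eta <= 1 ->
  0 <= eta -> `|e| <= eta -> `|k| <= eta -> (forall i, `|ai i| <= eta) -> 0 <= x ->
  `|source e k ai (fun=> 0) i x| <= 2 * C * K * eta / d * expR (- g * x).
Proof.
move=> h1 h0 he hk ha x0.
rewrite /source normrM [`|d^-1|]gtr0_norm ?invr_gt0 // [leRHS]mulrAC.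
rewrite ler_wpM2r ?invr_ge0 ?(ltW d0) // !addr0.
have W := wK x0.
have VV : V <= V ^+ 2 by rewrite expr2 ler_peMl // (le_trans ler01 V1).
apply: le_trans (ler_normD _ _) _.
have H := remainder_lipschitz i V1 h1 he hk (vV x0) cV (ha true) (ha false) (ha true) (ha false).
rewrite !subrr normr0 !addr0 [c + w x]addrC addrK -/C in H.
have {}H : `|remainder i e k (w x + c) (ai true) (ai false) -
    remainder i e k c (ai true) (ai false)| <= C * eta * (K * expR (- g * x)).
  by apply: le_trans H _; rewrite ler_wpM2l // mulr_ge0 // ltW.
have H2 : `|block_coef i * ((c + w x) ^+ 2 - c ^+ 2) * ai i| <=
    3 * (2 * V * (K * expR (- g * x))) * eta.
  rewrite normrM; apply: ler_pM => //; rewrite normrM.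
  apply: ler_pM => //; first by case: (i); rewrite /block_coef ger0_norm //; lra.
  have -> : (c + w x) ^+ 2 - c ^+ 2 = (c + (c + w x)) * w x by ring.
  rewrite normrM; apply: ler_pM => //.
  apply: le_trans (ler_normD _ _) _; have := vV x0; have := cV; lra.
rewrite [c + w x]addrC in H2 *; apply: le_trans (lerD H H2) _.
have KE : 0 <= eta * (K * expR (- g * x)) by rewrite !mulr_ge0 ?expR_ge0.
have -> : C * eta * (K * expR (- g * x)) + 3 * (2 * V * (K * expR (- g * x))) * eta =
  (C + 6 * V) * (eta * (K * expR (- g * x))) by ring.
have -> : 2 * C * K * eta * expR (- g * x) = (2 * C) * (eta * (K * expR (- g * x))) by ring.
by rewrite ler_wpM2r // /C; have := sqr_ge0 V; lra.
Qed.

Let source_continuous e k ai (u : bool * R -> R) i :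
  (forall j, continuous (fun x => u (j, x))) -> half_continuous (source e k ai u i).
Proof.
move=> cu.
have cc (j : bool) : half_continuous (fun x => ai j + u (j, x)).
  by apply: half_continuousD; [exact: half_continuous_cst|move=> x _; exact: cu].
have cv : half_continuous (fun x => c + w x).
  by apply: half_continuousD => //; exact: half_continuous_cst.
have cr := @half_continuous_remainder i e k _ _ _ cv (cc true) (cc false).
rewrite /source; apply: half_continuousM; last exact: half_continuous_cst.
apply: half_continuousD.
  by apply: half_continuousB; [exact: cr|exact: half_continuous_cst].
apply: half_continuousM; last exact: half_continuous_cst.
apply: half_continuousM; first exact: half_continuous_cst.
apply: half_continuousB; last exact: half_continuous_cst.
exact: half_continuousX.
Qed.

Let potential_le i x : 0 <= x ->
  `|potential d zt c w (block_coef i) x| <= (`|zt| + 3 * V ^+ 2) / d.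
Proof.
move=> x0; rewrite /potential normrM [`|d^-1|]gtr0_norm ?invr_gt0 //.
rewrite ler_wpM2r ?invr_ge0 ?(ltW d0) //.
apply: le_trans (ler_normB _ _) _; rewrite lerD // normrM normrX.
apply: ler_pM => //.
  by case: (i); rewrite /block_coef ger0_norm //; lra.
by rewrite ler_pXn2r ?nnegrE ?vV // (le_trans ler01 V1).
Qed.

(** The source is small at [u = 0], by the smallness of [e], [k] and [ai], and it is
    Lipschitz in [u] with a constant of the order of its size: the inverse of the
    linearization makes it a contraction of a small ball. *)
Lemma perturbation (rho : R) : 0 < rho -> exists2 delta : R, 0 < delta &
  forall (e k : R) (ai : bool -> R), `|e| <= delta -> `|k| <= delta ->
  (forall i, `|ai i| <= delta) ->
  exists (p p' p2 : bool -> R -> R) (K2 : R), forall i,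
    [/\ forall x, 0 <= x -> der (p i) x (p' i x),
        forall x, 0 <= x -> der (p' i) x (p2 i x), p' i 0 = 0,
        forall x, 0 <= x -> `|p i x| <= rho * expR (- g * x) &
        forall x, 0 <= x ->
          p2 i x = potential d zt c w (block_coef i) x * p i x -
                   source e k ai (fun z => p z.1 z.2) i x /\
          `|p2 i x| <= K2 * expR (- g * x)].
Proof.
move=> rho'0.
have CM : 0 < 8 * C * Mm by rewrite mulr_gt0 // mulr_gt0.
(* [8 * C * Mm * r <= d] makes the Lipschitz constant at most [1 / 2] on the ball of
   radius [r], where the arguments of the remainder are at most [2 * r <= 1]; the
   bound on [delta] keeps the image of [0] in the ball of radius [r / 2]. *)
pose r := Num.min (Num.min rho (1 / 2)) (d / (8 * C * Mm)).
have r0 : 0 < r by rewrite !lt_min rho'0 divr_gt0 //= divr_gt0.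
have r_rho : r <= rho by rewrite !ge_min lexx.
have r_half : r <= 1 / 2 by rewrite !ge_min lexx orbT.
have rCM : 8 * C * Mm * r <= d.
  by rewrite mulrC -ler_pdivlMr // !ge_min lexx orbT.
have K10 : 0 < K + 1 by rewrite ltr_wpDl.
have CMK : 0 < 4 * C * Mm * (K + 1) by rewrite mulr_gt0 // mulr_gt0 // mulr_gt0.
pose delta := Num.min r (r * d / (4 * C * Mm * (K + 1))).
have delta0 : 0 < delta by rewrite lt_min r0 divr_gt0 // mulr_gt0.
have delta_r : delta <= r by rewrite ge_min lexx.
have delta_CM : 4 * C * Mm * (K + 1) * delta <= r * d.
  by rewrite mulrC -ler_pdivlMr // ge_min lexx orbT.
exists delta => // e k ai he hk ha.
pose h u i := source e k ai u i.
pose T (u : bool * R -> R) (z : bool * R) := G z.1 (h u z.1) `|z.2|.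
pose wt (z : bool * R) := expR (- g * `|z.2|).
pose B0 := 2 * C * K * delta / d.
pose B z := C * (delta + r) * (2 * z) / d.
have C20 : 0 <= 2 * C by rewrite mulr_ge0 ?(ltW C0).
have B00 : 0 <= B0.
  apply: divr_ge0; last exact: ltW.
  by apply: mulr_ge0 (ltW delta0); apply: mulr_ge0.
have Bz0 z : 0 <= z -> 0 <= B z.
  move=> z0; apply: divr_ge0; last exact: ltW.
  apply: mulr_ge0; last by rewrite mulr_ge0.
  by apply: mulr_ge0 (ltW C0) _; rewrite addr_ge0 // ltW.
have dr1 : delta + r <= 1 by lra.
have MB0 : Mm * B0 <= r / 2.
  rewrite /B0 mulrA ler_pdivrMr //.
  have : 4 * C * Mm * K * delta <= 4 * C * Mm * (K + 1) * delta.
    apply: ler_wpM2r; first exact: ltW.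
    apply: ler_wpM2l; last by rewrite lerDl.
    by apply: mulr_ge0 (ltW Mm0); apply: mulr_ge0 (ltW C0).
  by lra.
have MBz z : 0 <= z -> Mm * B z <= z / 2.
  move=> z0; have -> : Mm * B z = C * Mm * (delta + r) * (2 * z) / d by rewrite /B; ring.
  rewrite ler_pdivrMr //.
  have A1 : C * Mm * (delta + r) <= C * Mm * (2 * r).
    by apply: ler_wpM2l; [exact: mulr_ge0 (ltW C0) (ltW Mm0)|lra].
  have A2 : C * Mm * (delta + r) * (2 * z) <= d / 4 * (2 * z).
    by rewrite ler_wpM2r ?mulr_ge0 //; lra.
  by lra.
have half (u : bool * R -> R) q : (forall z, `|u z| <= q * wt z) ->
    forall i x, 0 <= x -> `|u (i, x)| <= q * expR (- g * x).
  by move=> hu i x x0; have := hu (i, x); rewrite /wt /= (ger0_norm x0).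
have small (u : bool * R -> R) q : 0 <= q -> (forall z, `|u z| <= q * wt z) ->
    forall i x, 0 <= x -> `|u (i, x)| <= q.
  move=> q0 hu i x x0; apply: le_trans (half u q hu i x x0) _.
  by rewrite ler_piMr // e1.
have h0B i x : 0 <= x -> `|h (fun=> 0) i x| <= B0 * expR (- g * x).
  by move=> x0; apply: source0 => //; [lra|exact: ltW].
have hlip (u u' : bool * R -> R) z i x : (forall o, `|u o| <= r * wt o) ->
    (forall o, `|u' o| <= r * wt o) -> (forall o, `|u o - u' o| <= z * wt o) ->
    0 <= x -> `|h u i x - h u' i x| <= B z * expR (- g * x).
  move=> hu hu' uv x0; apply: source_lip => //; try exact: ltW.
  - by move=> j; apply: (small u r (ltW r0) hu).
  - by move=> j; apply: (small u' r (ltW r0) hu').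
  - by move=> j; have := uv (j, x); rewrite /wt /= (ger0_norm x0).
have z_ball o : `|(0 : R)| <= r * wt o by rewrite normr0 mulr_ge0 ?expR_ge0 // ltW.
have hB (u : bool * R -> R) i x : (forall o, `|u o| <= r * wt o) -> 0 <= x ->
    `|h u i x| <= (B0 + B r) * expR (- g * x).
  move=> hu x0; rewrite -[h u i x](subrK (h (fun=> 0) i x)) addrC.
  apply: le_trans (ler_normD _ _) _; rewrite mulrDl lerD ?h0B //.
  by apply: hlip => // y; rewrite subr0.
have BB : 0 <= B0 + B r by rewrite addr_ge0 // Bz0 // ltW.
have hc0 i : half_continuous (h (fun=> 0) i).
  by apply: source_continuous => j x; exact: cvg_cst.
have Tlip (u u' : bool * R -> R) z : (forall i, continuous (fun x => u (i, x))) ->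
    (forall i, continuous (fun x => u' (i, x))) ->
    (forall o, `|u o| <= r * wt o) -> (forall o, `|u' o| <= r * wt o) -> 0 <= z ->
    (forall o, `|u o - u' o| <= z * wt o) -> forall o, `|T u o - T u' o| <= z / 2 * wt o.
  move=> cu cu' hu hu' z0 uv [i x]; rewrite /T /=.
  have [_ GMi] := GM i.
  have [_ _ L] := GMi (h u i) (B0 + B r) (@source_continuous e k ai u i cu) BB
    (fun y hy => hB u i y hu hy).
  apply: le_trans (L (h u' i) (B0 + B r) (B z) `|x| (@source_continuous e k ai u' i cu') BB
    (Bz0 z z0) (fun y hy => hB u' i y hu' hy)
    (fun y hy => hlip u u' z i y hu hu' uv hy) (normr_ge0 x)) _.
  rewrite ler_wpM2r ?expR_ge0 //; apply: le_trans (MBz z z0).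
  by rewrite ler_wpM2r ?Bz0.
have [|||||u [cu uB uT]] := @weighted_fixed_point R (bool * R)%type wt
   (fun u => forall i, continuous (fun x => u (i, x))) T r _ (ltW r0).
- by move=> z; exact: expR_ge0.
- by move=> i x; exact: cvg_cst.
- move=> u cu hu; split=> [i|].
    have [_ GMi] := GM i.
    have [[r' [dG _ _]] _ _] := GMi (h u i) (B0 + B r) (@source_continuous e k ai u i cu) BB
      (fun y hy => hB u i y hu hy).
    have := @half_continuous_even R (G i (h u i)); apply => x x0.
    exact: is_derive_cont (dG x x0).
  have c0 i : continuous (fun x => (fun=> 0 : R) (i, x)) by move=> x; exact: cvg_cst.
  move=> [i x]; have u0 o : `|u o - 0| <= r * wt o by rewrite subr0.
  have A := Tlip u (fun=> 0) r cu c0 hu z_ball (ltW r0) u0 (i, x).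
  have A0 : `|T (fun=> 0) (i, x)| <= r / 2 * wt (i, x).
    have [_ GMi] := GM i.
    have [_ L _] := GMi (h (fun=> 0) i) B0 (hc0 i) B00 (fun y hy => h0B i y hy).
    apply: le_trans (L `|x| (normr_ge0 x)) _.
    rewrite ler_wpM2r ?expR_ge0 //; apply: le_trans MB0.
    by rewrite ler_wpM2r.
  rewrite -[T u _](subrK (T (fun=> 0) (i, x))); apply: le_trans (ler_normD _ _) _.
  by rewrite [r]splitr mulrDl lerD.
- by move=> u u' z cu cu' hu hu'; exact: Tlip.
- move=> u_ v cu uv i.
  apply: (@weighted_limit_continuous _ (fun x => expR (- g * `|x|))
    (fun n x => u_ n (i, x)) (fun x => v (i, x)) (2 * r)) => //.
  + by rewrite mulr_ge0 // ltW.
  + have := @half_continuous_even R (fun x => expR (- g * x)); apply => x x0.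
    exact: is_derive_cont (is_derive_expl _ x).
have inv i := (GM i).2 (h u i) (B0 + B r) (@source_continuous e k ai u i cu) BB
  (fun y hy => hB u i y uB hy).
have der_ex i : exists r', [/\ forall x, 0 <= x -> der (G i (h u i)) x (r' x),
    forall x, 0 <= x -> der r' x (potential d zt c w (block_coef i) x * G i (h u i) x -
      h u i x) & r' 0 = 0].
  by have [] := inv i.
have [p' Hp'] := choice der_ex.
have pu i x : 0 <= x -> G i (h u i) x = u (i, x).
  by move=> x0; rewrite -(uT (i, x)) /T /= (ger0_norm x0).
exists (fun i => G i (h u i)), p', (fun i x => potential d zt c w (block_coef i) x *
  G i (h u i) x - h u i x), ((`|zt| + 3 * V ^+ 2) / d * r + (B0 + B r)) => i.
have [dG dp' p'0] := Hp' i; split.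
- exact: dG.
- exact: dp'.
- exact: p'0.
- move=> x x0; rewrite pu //; apply: le_trans (half u r uB i x x0) _.
  by rewrite ler_wpM2r ?expR_ge0.
- move=> x x0; split; first by rewrite /h /source /= !pu.
  apply: le_trans (ler_normB _ _) _; rewrite mulrDl lerD ?hB //.
  rewrite pu // normrM -[leRHS]mulrA; apply: ler_pM => //; first exact: potential_le.
  exact: half u r uB i x x0.
Qed.

End Perturbation.

(** * Even profiles of the rescaled equation *)

Section ProfileExistence.
Context {R : realType}.
Implicit Types (x y : R) (i : bool).

(** The rescaled equation reads [d X'' = vector_field true X Y] and
    [d Y'' = vector_field false X Y] for the unknown [U = X + i Y]. *)
Definition vector_field (zt ft e k : R) i X Y : R :=
  let N := X ^+ 2 + Y ^+ 2 in
  if i then zt * X + e * Y - N * X + k * N * Y + ft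
  else zt * Y - e * X - N * Y - k * N * X.

Lemma half_continuous_vector_field zt ft e k i (f g : R -> R) : half_continuous f ->
  half_continuous g -> half_continuous (fun x => vector_field zt ft e k i (f x) (g x)).
Proof.
move=> cf cg; case: i; rewrite /vector_field; repeat lazymatch goal with
  | |- half_continuous (fun x => @?f x - @?g x) => apply: half_continuousB
  | |- half_continuous (fun x => @?f x + @?g x) => apply: half_continuousD
  | |- half_continuous (fun x => @?f x * @?g x) => apply: half_continuousM
  | |- half_continuous (fun x => @?f x ^+ ?n) => apply: half_continuousX
  | |- half_continuous f => exact: cf
  | |- half_continuous g => exact: cg
  | |- half_continuous (fun x => ?f x) => change (half_continuous f)
  | |- half_continuous (fun=> _) => exact: half_continuous_cst
  end.
Qed.

(** The profile [c + w] and its correction, extended evenly.  The last clause, whose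
    constant [c1] does not depend on the parameters, is what gives the lower bound
    on the norm and separates the families [s = 1] and [s = -1]. *)
Lemma profile_exists (d zt ft c s : R) : 0 < d -> ft != 0 ->
  zt * c - c ^+ 3 + ft = 0 -> 0 < zt - 3 * c ^+ 2 -> s * s = 1 ->
  exists delta c1 : R, [/\ 0 < delta, 0 < c1 &
  forall e k : R, `|e| <= delta -> `|k| <= delta ->
  exists (Z Z1 Z2 : bool -> R -> R) (Zi : bool -> R) (K g : R),
  [/\ 0 < g,
      forall i, [/\ forall x, der (Z i) x (Z1 i x), forall x, der (Z1 i) x (Z2 i x),
        continuous (Z2 i), Z1 i 0 = 0 & forall x, Z i (- x) = Z i x],
      forall i x, [/\ `|Z i x - Zi i| <= K * expR (- g * `|x|),
        `|Z1 i x| <= K * expR (- g * `|x|) & `|Z2 i x| <= K * expR (- g * `|x|)],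
      forall i x, d * Z2 i x = vector_field zt ft e k i (Z true x) (Z false x) &
      forall x, 0 <= x -> x <= 1 -> c1 <= s * (Z true x - Zi true)]].
Proof.
move=> d0 ft0 eqc al0 ss.
pose al := zt - 3 * c ^+ 2.
have [w [w' [K [dw dw' wK w'0 [w'_gt0 w_gt0]]]]] := homoclinic_profile c d0 al0 ss.
pose m := Num.sqrt (al / d); rewrite -/al -/m in wK.
have m0 : 0 < m by rewrite sqrtr_gt0 divr_gt0.
(* Any rate below [m] would do: [w] decays at rate [m], which is also the smaller of
   the two rates of the linearization. *)
pose g := m / 2.
have g0 : 0 < g by rewrite divr_gt0.
have gm : g < m by rewrite /g; lra.
have den i : 0 < zt - block_coef i * c ^+ 2 /\ g < Num.sqrt ((zt - block_coef i * c ^+ 2) / d).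
  have le : al <= zt - block_coef i * c ^+ 2.
    by have := sqr_ge0 c; rewrite /al /block_coef; case: i; lra.
  split; first exact: lt_le_trans le.
  apply: lt_le_trans gm _; rewrite ler_wsqrtr // ler_wpM2r // invr_ge0; exact: ltW.
have w13 i : block_coef i = 1 :> R \/ block_coef i = 3 :> R.
  by case: i; rewrite /block_coef; [right|left].
have inv i := linearization_inverse d0 ft0 m0 eqc dw dw' wK w'0 w'_gt0
  (den i).1 g0 (den i).2 (w13 i).
have [G /choice[M GM]] := choice inv.
have K0 : 0 <= K.
  have := le_trans (normr_ge0 _) (wK 0 (lexx 0)).
  by rewrite mulr0 expR0 mulr1.
have mg x : 0 <= x -> expR (- m * x) <= expR (- g * x).
  by move=> x0; rewrite ler_expR !mulNr lerN2 ler_wpM2r // ltW.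
have wg x : 0 <= x -> `|w x| <= K * expR (- g * x).
  by move=> x0; apply: le_trans (wK x x0) _; rewrite ler_wpM2l ?mg.
have [A w2A] := profile_second_decay zt c d0 m0 wK.
have A0 : 0 <= A.
  have := le_trans (normr_ge0 _) (w2A 0 (lexx 0)).
  by rewrite mulr0 expR0 mulr1.
have cw : half_continuous w by move=> x _; exact: is_derive_cont (dw x).
(* The correction stays below half of the least size of [w] on [[0, 1]]. *)
pose c1 := s * w 1 / 2.
have c10 : 0 < c1 by rewrite divr_gt0.
have [delta1 delta10 pert] := perturbation d0 g0 cw wg GM c10.
have [delta2 delta20 equi] := equilibrium al0 delta10.
exists (Num.min delta1 delta2), c1; split=> //; first by rewrite lt_min delta10.
move=> e k; rewrite le_min => /andP[e1 e2]; rewrite le_min => /andP[k1 k2].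
have [ai [aiB aiE]] := equi e k e2 k2.
have [p [p' [p2 [K2 Hp]]]] := pert e k ai e1 k1 aiB.
pose w2 x := (al * w x - 3 * c * w x ^+ 2 - w x ^+ 3) / d.
pose Zi i := (if i then c else 0) + ai i.
pose H i x := Zi i + (if i then w x else 0) + p i x.
pose H1 i x := (if i then w' x else 0) + p' i x.
pose H2 i x := (if i then w2 x else 0) + p2 i x.
have dH i x : 0 <= x -> der (H i) x (H1 i x).
  move=> x0; have [/(_ x x0) dp _ _ _ _] := Hp i.
  rewrite /H /H1; case: i dp => dp.
    by apply: is_derive_val (is_derive_addf (is_derive_addf (is_derive_cstf _ x) (dw x)) dp);
      rewrite add0r.
  by apply: is_derive_val (is_derive_addf (is_derive_cstf _ x) dp).
have dH1 i x : 0 <= x -> der (H1 i) x (H2 i x).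
  move=> x0; have [_ /(_ x x0) dp _ _ _] := Hp i.
  rewrite /H1 /H2; case: i dp => dp; first exact: is_derive_addf (dw' x) dp.
  by apply: is_derive_val (is_derive_addf (is_derive_cstf _ x) dp).
have H10 i : H1 i 0 = 0.
  by have [_ _ h _ _] := Hp i; rewrite /H1 h addr0; case: (i).
have EH i x : 0 <= x -> H2 i x = vector_field zt ft e k i (H true x) (H false x) / d.
  move=> x0; have [_ _ _ _ /(_ x x0)[E _]] := Hp i.
  have Eft : ft = c ^+ 3 - zt * c by have := eqc; lra.
  rewrite /H2 E /source -aiE /H /Zi /w2 Eft /potential /vector_field /remainder /block_coef /al /=.
  by case: i {E} => /=; move: (p true x) (p false x) => P Q; ring.
have HB i x : 0 <= x -> `|H i x - Zi i| <= (K + c1) * expR (- g * x).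
  move=> x0; have [_ _ _ /(_ x x0) hp _] := Hp i.
  have -> : H i x - Zi i = (if i then w x else 0) + p i x.
    by rewrite /H; move: (if i then w x else 0) => q; ring.
  apply: le_trans (ler_normD _ _) _; rewrite mulrDl lerD //.
  by case: (i); [exact: wg|rewrite normr0 mulr_ge0 ?expR_ge0].
have H2B i x : 0 <= x -> `|H2 i x| <= (A + `|K2|) * expR (- g * x).
  move=> x0; have [_ _ _ _ /(_ x x0)[_ hp]] := Hp i.
  apply: le_trans (ler_normD _ _) _; rewrite mulrDl lerD //; last first.
    by apply: le_trans hp _; rewrite ler_wpM2r ?expR_ge0 // ler_norm.
  case: (i); last by rewrite normr0 mulr_ge0 ?expR_ge0.
  by apply: le_trans (w2A x x0) _; rewrite ler_wpM2l ?mg.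
pose B := (K + c1) + (K + c1) + (A + `|K2|).
have Kc0 : 0 <= K + c1 by rewrite addr_ge0 // ltW.
have AK0 : 0 <= A + `|K2| by rewrite addr_ge0.
have H1B i x : 0 <= x -> `|H1 i x| <= B * expR (- g * x).
  move=> x0; apply: (derive_decay g0 _ (dH1 i) (HB i) (H2B i) x0) => y y0.
  apply: is_derive_val (is_derive_addf (dH i y y0) (is_derive_cstf (- Zi i) y)).
  by rewrite addr0.
have cH i : half_continuous (H i) by move=> x x0; exact: is_derive_cont (dH i x x0).
exists (fun i x => H i `|x|), (fun i x => Num.sg x * H1 i `|x|),
  (fun i x => H2 i `|x|), Zi, B, g; split=> //.
- move=> i; split.
  + exact: is_derive_even (dH i) (H10 i).
  + exact: is_derive_odd (dH1 i) (H10 i).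
  + have -> : (fun x => H2 i `|x|) = (fun x => (fun y =>
        d^-1 * vector_field zt ft e k i (H true y) (H false y)) `|x|).
      by apply/funext => x; rewrite EH // mulrC.
    have cF : half_continuous
        (fun y => d^-1 * vector_field zt ft e k i (H true y) (H false y)).
      apply: half_continuousM; first exact: half_continuous_cst.
      by apply: half_continuous_vector_field; exact: cH.
    exact: (half_continuous_even cF).
  + by rewrite sgr0 mul0r.
  + by move=> x; rewrite normrN.
- move=> i x; have x0 := normr_ge0 x; split.
  + apply: le_trans (HB i _ x0) _; rewrite ler_wpM2r ?expR_ge0 // /B; lra.
  + rewrite normrM; apply: le_trans (H1B i _ x0); rewrite ler_piMl //.
    by rewrite normr_sg; case: (x != 0).
  + apply: le_trans (H2B i _ x0) _; rewrite ler_wpM2r ?expR_ge0 // /B; lra.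
- by move=> i x; rewrite EH // mulrC divfK // gt_eqF.
- move=> x x0 x1; rewrite (ger0_norm x0).
  have -> : s * (H true x - Zi true) = s * w x + s * p true x by rewrite /H /=; ring.
  have s1 : `|s| = 1.
    have : `|s| ^+ 2 = 1 by rewrite -normrX expr2 ss normr1.
    by move=> /eqP; rewrite sqrp_eq1 // => /eqP.
  have sp : `|s * p true x| <= c1.
    rewrite normrM s1 mul1r; have [_ _ _ /(_ x x0) hp _] := Hp true.
    apply: le_trans hp _; rewrite ler_piMr ?(ltW c10) // expR_le1 mulNr oppr_le0.
    by rewrite mulr_ge0 // ltW.
  have dsw y : 0 <= y -> der (fun y => - s * w y) y (- s * w' y).
    by move=> _; exact: is_derive_cmulf (dw y).
  have sw'0 y : 0 <= y -> 0 <= - s * w' y.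
    by rewrite le_eqVlt => /orP[/eqP<-|/w'_gt0/ltW//]; rewrite w'0 mulr0.
  have sw := ge0_derive_le dsw sw'0 x0 x1.
  move: sp; rewrite ler_norml => /andP[sp _].
  by have : s * w 1 = c1 + c1; [rewrite /c1; field|move: sw sp; rewrite !mulNr; lra].
Qed.

End ProfileExistence.

(** * Square integrability and weak derivatives *)

Section SobolevSpace.
Context {R : realType}.
Implicit Types (x y : R).
Local Notation mu := (@lebesgue_measure R).

Lemma integral_exp_abs_lt_pinfty (k : R) : 0 < k ->
  (\int[mu]_x (expR (- k * `|x|))%:E < +oo)%E.
Proof.
move=> k0.
have c : continuous (fun x => expR (- k * `|x|)).
  have := @half_continuous_even R (fun x => expR (- k * x)); apply => x _.
  exact: is_derive_cont (is_derive_expl _ x).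
have even_e : (fun x => expR (- k * `|x|)) =1 (fun x => expR (- k * `|x|)) \o -%R.
  by move=> x /=; rewrite normrN.
rewrite (ge0_symfun_integralT (fun x => expR_ge0 _) c even_e).
rewrite -set_itvcy.
pose F x := - k^-1 * expR (- k * x).
have dF x : der F x (expR (- k * x)).
  apply: is_derive_val (is_derive_cmulf (- k^-1) (is_derive_expl (- k) x)).
  by rewrite mulrA mulrNN mulVf ?mul1r // gt_eqF.
have -> : (\int[mu]_(x in `[0%R, +oo[) (expR (- k * `|x|))%:E =
    \int[mu]_(x in `[0%R, +oo[) (expR (- k * x))%:E)%E.
  apply: eq_integral => x; rewrite inE /= in_itv /= andbT => x0.
  by rewrite ger0_norm.
rewrite (@ge0_continuous_FTC2y R _ F 0 0).
- by rewrite -EFinB -EFinM ltry.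
- by move=> x _; exact: expR_ge0.
- apply: continuous_subspaceT => x; exact: is_derive_cont (is_derive_expl _ x).
- have -> : (0 : R) = - k^-1 * 0 by rewrite mulr0.
  apply: cvgM; first exact: cvg_cst.
  under eq_fun do rewrite mulNr.
  by apply: (@cvg_comp _ _ _ _ (fun x => expR (- x))); [exact: gt0_cvgMry|exact: cvgr_expR].
- by move=> x _; have [] := is_derive_derive1 (dF x).
- by apply: cvg_at_right_filter; exact: is_derive_cont (dF 0).
- by move=> x _; have [] := is_derive_derive1 (dF x).
Qed.

Lemma integral_sqr_decay (f : R -> R) (K g : R) : 0 < g -> continuous f ->
  (forall x, `|f x| <= K * expR (- g * `|x|)) ->
  (\int[mu]_x (f x ^+ 2)%:E < +oo)%E.
Proof.
move=> g0 cf fK.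
have g20 : 0 < 2 * g by rewrite mulr_gt0.
apply: (@le_lt_trans _ _ (\int[mu]_x ((K ^+ 2)%:E * (expR (- (2 * g) * `|x|))%:E))%E).
  apply: ge0_le_integral => //.
  - by move=> x _; rewrite lee_fin sqr_ge0.
  - apply/measurable_EFinP; apply: measurable_funX.
    exact: continuous_measurable_fun.
  - apply/measurable_EFinP; apply: measurable_funM => //.
    apply: continuous_measurable_fun.
    have := @half_continuous_even R (fun x => expR (- (2 * g) * x)); apply => x _.
    exact: is_derive_cont (is_derive_expl _ x).
  - move=> x _; rewrite -EFinM lee_fin.
    have -> : K ^+ 2 * expR (- (2 * g) * `|x|) = (K * expR (- g * `|x|)) ^+ 2.
      by rewrite exprMn -expRM_natl; congr (_ * expR _); ring.
    rewrite -[X in X <= _]ger0_norm ?sqr_ge0 // normrX ler_pXn2r ?nnegrE //.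
    exact: le_trans (fK x).
rewrite ge0_integralZl //.
- by rewrite lte_mul_pinfty ?lee_fin ?sqr_ge0 // integral_exp_abs_lt_pinfty.
- apply/measurable_EFinP; apply: continuous_measurable_fun.
  have := @half_continuous_even R (fun x => expR (- (2 * g) * x)); apply => x _.
  exact: is_derive_cont (is_derive_expl _ x).
- by rewrite lee_fin sqr_ge0.
Qed.

Lemma Lfun2_decay (f : R -> R) (K g : R) : 0 < g -> continuous f ->
  (forall x, `|f x| <= K * expR (- g * `|x|)) -> f \in Lfun mu 2%:E.
Proof.
move=> g0 cf fK; rewrite inE; apply/andP; split; rewrite inE /=.
  exact: continuous_measurable_fun.
rewrite /finite_norm; apply: (@lty_poweRy _ _ 2) => //.
rewrite poweR_Lnorm //.
under eq_integral do rewrite /= powR_mulrn ?normr_ge0 // -normrX ger0_norm ?sqr_ge0 //.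
exact: integral_sqr_decay fK.
Qed.

Lemma derivable_LRcontinuous (f f' : R -> R) (a b : R) :
  (forall x, der f x (f' x)) -> derivable_oo_LRcontinuous f a b.
Proof.
move=> df; split=> [x _||].
- by have [] := is_derive_derive1 (df x).
- by apply: cvg_at_right_filter; exact: is_derive_cont (df a).
- by apply: cvg_at_left_filter; exact: is_derive_cont (df b).
Qed.

Lemma Rintegral_support (f : R -> R) (a : R) : (forall x, a < `|x| -> f x = 0) ->
  \int[mu]_x f x = \int[mu]_(x in `[- a, a]) f x.
Proof.
move=> fa; rewrite [RHS]Rintegral_mkcond; congr (Rintegral _ _ _).
apply/funext => x; rewrite patchE; case: ifPn => // /negP xa.
apply: fa; rewrite ltNge; apply/negP => xa'; apply: xa.
by rewrite inE /= in_itv /= -ler_norml.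
Qed.

Lemma test_function_support (phi : R -> R) : test_function phi ->
  exists2 a, 0 < a & forall x, a <= `|x| -> phi x = 0 /\ derive1 phi x = 0.
Proof.
move=> [_ /compact_bounded [M [_ HM]]].
have M1 : M < Num.max M 0 + 1 by rewrite ltr_pwDr // le_max lexx.
have {HM} H := HM _ M1.
(* One more unit, for [phi] to vanish in a neighborhood of every [x] considered. *)
pose a := Num.max M 0 + 2.
have a0 : 0 < a by rewrite ltr_wpDl // le_max lexx orbT.
have phi0 x : Num.max M 0 + 1 < `|x| -> phi x = 0.
  move=> xM; apply/eqP/negPn/negP => p0.
  have cx : closure [set x | phi x != 0] x by apply: subset_closure.
  by have := H x cx; rewrite /= leNgt xM.
exists a => // x ax.
have xM : Num.max M 0 + 1 < `|x| by apply: lt_le_trans ax; rewrite /a; lra.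
split; first exact: phi0.
have d0 : der phi x 0.
  have dc := is_derive_cstf 0 x; apply: near_eq_is_derive dc.
  have : \forall y \near x, Num.max M 0 + 1 < `|y|.
    exact: cvgr_gt (@norm_continuous R R x) _ xM.
  by apply: filterS => y /phi0 ->.
by have [] := is_derive_derive1 d0.
Qed.

(** The boundary terms vanish on an interval beyond the support of [phi]. *)
Lemma integral_by_parts_test (f f' phi : R -> R) : (forall x, der f x (f' x)) ->
  continuous f' -> test_function phi ->
  \int[mu]_x (f x * derive1 phi x) = - \int[mu]_x (f' x * phi x).
Proof.
move=> df cf' tphi; have [a a0 H] := test_function_support tphi.
have [dphi _] := tphi.
have dp x : der phi x (derive1 phi x).
  by have := dphi 0%N x; rewrite derive1n0 => /derivableP; rewrite derive1E.
have cp' : continuous (derive1 phi).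
  move=> x; have := dphi 1%N x; rewrite derive1n1 => /derivable1_diffP.
  exact: differentiable_continuous.
rewrite (@Rintegral_support _ a); last first.
  by move=> x /ltW/H[_ ->]; rewrite mulr0.
rewrite (@Rintegral_support (fun x => f' x * phi x) a); last first.
  by move=> x /ltW/H[-> _]; rewrite mulr0.
have Na : - a < a by lra.
rewrite (@Rintegration_by_parts R f phi f' (derive1 phi) (- a) a Na).
- have [-> _] : phi a = 0 /\ derive1 phi a = 0 by apply: H; rewrite ger0_norm // ltW.
  have [-> _] : phi (- a) = 0 /\ derive1 phi (- a) = 0.
    by apply: H; rewrite normrN ger0_norm // ltW.
  by rewrite !mulr0 subrr sub0r.
- exact: continuous_subspaceT.
- exact: derivable_LRcontinuous df.
- by move=> x _; have [] := is_derive_derive1 (df x).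
- exact: continuous_subspaceT.
- exact: derivable_LRcontinuous dp.
- by [].
Qed.

Lemma H2_of_decay (U U1 U2 V V1 V2 : R -> R) (K g : R) : 0 < g ->
  (forall x, der U x (U1 x)) -> (forall x, der U1 x (U2 x)) -> continuous U2 ->
  (forall x, der V x (V1 x)) -> (forall x, der V1 x (V2 x)) -> continuous V2 ->
  (forall x, [/\ `|U x| <= K * expR (- g * `|x|), `|U1 x| <= K * expR (- g * `|x|) &
    `|U2 x| <= K * expR (- g * `|x|)]) ->
  (forall x, [/\ `|V x| <= K * expR (- g * `|x|), `|V1 x| <= K * expR (- g * `|x|) &
    `|V2 x| <= K * expR (- g * `|x|)]) ->
  H2 (fun x => U x +i* V x)%C.
Proof.
move=> g0 dU dU1 cU2 dV dV1 cV2 UK VK.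
have cont (f f' : R -> R) : (forall x, der f x (f' x)) -> continuous f.
  by move=> df x; exact: is_derive_cont (df x).
have L2p (f h : R -> R) : continuous f -> continuous h ->
    (forall x, `|f x| <= K * expR (- g * `|x|)) ->
    (forall x, `|h x| <= K * expR (- g * `|x|)) -> L2 (fun x => f x +i* h x)%C.
  by move=> cf ch fK hK; split; apply: (@Lfun2_decay _ K g).
have weak (f f' h h' : R -> R) : (forall x, der f x (f' x)) -> continuous f' ->
    (forall x, der h x (h' x)) -> continuous h' ->
    weak_derivative (fun x => f x +i* h x)%C (fun x => f' x +i* h' x)%C.
  by move=> df cf dh ch phi tphi; split; exact: integral_by_parts_test.
split.
  apply: L2p; [exact: cont dU|exact: cont dV| |]; move=> x.
    by have [] := UK x.
  by have [] := VK x.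
exists (fun x => U1 x +i* V1 x)%C, (fun x => U2 x +i* V2 x)%C; split.
- by apply: weak => //; [exact: cont dU1|exact: cont dV1].
- apply: L2p; [exact: cont dU1|exact: cont dV1| |]; move=> x.
    by have [] := UK x.
  by have [] := VK x.
- by apply: weak.
- apply: L2p => // x; first by have [] := UK x.
  by have [] := VK x.
Qed.

Lemma H2norm_ge (u : R -> R[i]) : L2norm u <= H2norm u.
Proof.
have u0 : 0 <= L2norm u by rewrite fine_ge0 // Lnorm_ge0.
rewrite -[leLHS]ger0_norm // -sqrtr_sqr /H2norm.
by rewrite ler_wsqrtr // -addrA lerDl addr_ge0 // sqr_ge0.
Qed.

Lemma L2norm_ge (U V : R -> R) (K g b c : R) : 0 < g -> continuous U -> continuous V ->
  (forall x, `|U x| <= K * expR (- g * `|x|)) ->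
  (forall x, `|V x| <= K * expR (- g * `|x|)) ->
  0 < b -> (forall x, 0 <= x -> x <= b -> c ^+ 2 <= U x ^+ 2 + V x ^+ 2) ->
  c ^+ 2 * b <= L2norm (fun x => U x +i* V x)%C ^+ 2.
Proof.
move=> g0 cU cV UK VK b0 Uc.
pose f x := (U x ^+ 2 + V x ^+ 2)%:E.
have mU2 : measurable_fun [set: R] (fun x => (U x ^+ 2)%:E).
  by apply/measurable_EFinP; apply: measurable_funX; exact: continuous_measurable_fun.
have mV2 : measurable_fun [set: R] (fun x => (V x ^+ 2)%:E).
  by apply/measurable_EFinP; apply: measurable_funX; exact: continuous_measurable_fun.
have mf : measurable_fun [set: R] f.
  by rewrite /f; under eq_fun do rewrite EFinD; exact: emeasurable_funD.
have If : (\int[mu]_x f x < +oo)%E.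
  rewrite /f; under eq_integral do rewrite EFinD.
  rewrite ge0_integralD //.
  - apply: lte_add_pinfty; first exact: integral_sqr_decay g0 cU UK.
    exact: integral_sqr_decay g0 cV VK.
  - by move=> x _; rewrite lee_fin sqr_ge0.
  - by move=> x _; rewrite lee_fin sqr_ge0.
pose N := ('N[mu]_2%:E [ (fun x => (ComplexField.Normc.normc (U x +i* V x)%C)%:E) ])%E.
have N2 : (N `^ 2 = \int[mu]_x f x)%E.
  rewrite /N poweR_Lnorm //; apply: eq_integral => x _ /=.
  rewrite powR_mulrn ?normr_ge0 // ger0_norm ?sqrtr_ge0 // sqr_sqrtr //.
  by rewrite addr_ge0 // sqr_ge0.
have Nfin : N \is a fin_num.
  rewrite ge0_fin_numE ?Lnorm_ge0 //; apply: (@lty_poweRy _ _ 2) => //.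
  by rewrite N2.
have -> : L2norm (fun x => U x +i* V x)%C ^+ 2 = fine (\int[mu]_x f x)%E.
  rewrite -N2 /L2norm -/N -(fineK Nfin) poweR_EFin /= powR_mulrn //.
  by rewrite fine_ge0 // Lnorm_ge0.
rewrite -lee_fin fineK; last first.
  rewrite ge0_fin_numE //; apply: integral_ge0 => x _.
  by rewrite lee_fin addr_ge0 // sqr_ge0.
apply: (@le_trans _ _ (\int[mu]_(x in `[0%R, b]) f x)%E); last first.
  apply: ge0_subset_integral => //.
  - by move=> x _; rewrite lee_fin addr_ge0 // sqr_ge0.
apply: (@le_trans _ _ (\int[mu]_(x in `[0%R, b]) (cst (c ^+ 2)%:E) x)%E).
  have E : mu `[0%R, b]%classic = b%:E.
    by rewrite lebesgue_measure_itv /= lte_fin b0 oppr0 adde0.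
  by rewrite integral_cst //= E -EFinM.
apply: ge0_le_integral => //.
- by move=> x _; rewrite lee_fin sqr_ge0.
- exact: measurable_funTS.
- by move=> x; rewrite /= in_itv /= => /andP[x0 xb]; rewrite lee_fin; exact: Uc.
Qed.

End SobolevSpace.

(** * Solutions of the original equation *)

Section SolutionFamily.
Context {R : realType}.
Implicit Types (x y : R) (i : bool).

Lemma powR_three_halves (a : R) : 0 <= a -> a `^ (3 / 2) = Num.sqrt a ^+ 3.
Proof.
by move=> a0; rewrite mulrC powRrM powR12_sqrt // powR_mulrn // sqrtr_ge0.
Qed.

(** The cubic has a root between its critical points [+- sqrt (zt / 3)], where
    its values have opposite signs exactly because [ft] is small. *)
Lemma constant_state (zt ft : R) : 0 < zt ->
  `|ft| < 2 * Num.sqrt 3 / 9 * zt `^ (3 / 2) ->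
  exists2 c, zt * c - c ^+ 3 + ft = 0 & 0 < zt - 3 * c ^+ 2.
Proof.
move=> zt0; rewrite powR_three_halves ?ltW // => ft_small.
(* [h] is the critical point [sqrt (zt / 3)]. *)
pose h := Num.sqrt zt * Num.sqrt 3 / 3.
have s3 : Num.sqrt 3 ^+ 2 = 3 :> R by rewrite sqr_sqrtr.
have sz : Num.sqrt zt ^+ 2 = zt by rewrite sqr_sqrtr // ltW.
have h2 : h ^+ 2 = zt / 3.
  have -> : h ^+ 2 = Num.sqrt zt ^+ 2 * Num.sqrt 3 ^+ 2 / 9 by rewrite /h; field.
  by rewrite s3 sz; field.
have h0 : 0 < h by rewrite divr_gt0 // mulr_gt0 // sqrtr_gt0.
have ph : `|ft| < zt * h - h ^+ 3.
  have -> : zt * h - h ^+ 3 = 2 / 3 * zt * h by rewrite exprS h2; field.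
  have -> : 2 / 3 * zt * h = 2 * Num.sqrt 3 / 9 * (Num.sqrt zt ^+ 3).
    by rewrite [X in _ = _ * X]exprS sz /h; field.
  exact: ft_small.
pose P x := zt * x - x ^+ 3 + ft.
have cP : continuous P.
  move=> x; have d := is_derive_idf x.
  have D := is_derive_addf (is_derive_addf (is_derive_cmulf zt d)
    (is_derive_oppf (is_derive_mulf d (is_derive_mulf d d)))) (is_derive_cstf ft x).
  exact: is_derive_cont D.
have Ph : 0 < P h.
  by rewrite /P; move: (ler_norm (- ft)) ph; rewrite normrN; lra.
have PNh : P (- h) < 0.
  rewrite /P; have -> : zt * - h - (- h) ^+ 3 = - (zt * h - h ^+ 3) by ring.
  by move: (ler_norm ft) ph; lra.
have hh : - h <= h by lra.
have Pb : Num.min (P (- h)) (P h) <= 0 <= Num.max (P (- h)) (P h).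
  by rewrite ge_min le_max (ltW Ph) (ltW PNh) orbT.
have [c cI Pc] := IVT hh (continuous_subspaceT cP) Pb.
exists c => //; have : c ^+ 2 < h ^+ 2; last by rewrite h2; lra.
move: cI; rewrite in_itv /= => /andP[c1 c2].
have c1' : - h < c by rewrite lt_neqAle c1 andbT; apply/eqP => E; move: PNh; rewrite E Pc ltxx.
have c2' : c < h by rewrite lt_neqAle c2 andbT; apply/eqP => E; move: Ph; rewrite -E Pc ltxx.
rewrite -[c ^+ 2]ger0_norm ?sqr_ge0 // normrX ltr_pXn2r ?nnegrE ?(ltW h0) //.
by rewrite ltr_norml c1' c2'.
Qed.

Lemma complex_equation (d zeta f kappa A B A2 B2 : R) :
  - (d * A2) + B + zeta * A - (A ^+ 2 + B ^+ 2) * (A - kappa * B) = 0 ->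
  - (d * B2) - A + zeta * B - (A ^+ 2 + B ^+ 2) * (B + kappa * A) + f = 0 ->
  (- d%:C * (A2 +i* B2) - ('i - zeta%:C) * (A +i* B)
     - (1 + 'i * kappa%:C) * `|A +i* B| ^+ 2 * (A +i* B) + 'i * f%:C = 0)%C.
Proof.
move=> E1 E2; rewrite normc_def /= -rmorphXn sqr_sqrtr ?addr_ge0 ?sqr_ge0 //.
apply/eqP; rewrite eq_complex /=; apply/andP; split; apply/eqP.
  by apply: etrans E1; ring.
by apply: etrans E2; ring.
Qed.

Lemma exp_decay_small (K g e : R) : 0 < g -> 0 <= K -> 0 < e ->
  exists2 X, 0 < X & forall x, X <= `|x| -> K * expR (- g * `|x|) < e.
Proof.
move=> g0 K0 e0; exists (K / (g * e) + 1).
  by rewrite ltr_wpDl // divr_ge0 // mulr_ge0 // ltW.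
move=> x Xx; rewrite mulNr expRN ltr_pdivrMr ?expR_gt0 //.
apply: (@lt_le_trans _ _ (e * (1 + g * `|x|))); last first.
  by rewrite ler_wpM2l ?expR_ge1Dx // ltW.
have h : K / (g * e) < `|x| by lra.
by rewrite ltr_pdivrMr ?mulr_gt0 // in h; lra.
Qed.

Lemma limit_of_decay (A B : R -> R) (Ai Bi K g : R) : 0 < g -> 0 <= K ->
  (forall x, `|A x - Ai| <= K * expR (- g * `|x|)) ->
  (forall x, `|B x - Bi| <= K * expR (- g * `|x|)) ->
  limit_at_infinity (fun x => A x +i* B x)%C (Ai +i* Bi)%C.
Proof.
move=> g0 K0 hA hB.
have key (F : set_system R) : Filter F -> (forall X : R, \forall x \near F, X <= `|x|) ->
    ((A x +i* B x)%C : R[i]^o) @[x --> F] --> ((Ai +i* Bi)%C : R[i]^o).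
  move=> FF HF; apply/(@cvgrPdist_lt R[i] R[i]^o) => e e0.
  move: (e0); rewrite ltcE /= => /andP[/eqP Ime e1].
  have e2 : 0 < complex.Re e / 2 by rewrite divr_gt0.
  have [X X0 HX] := exp_decay_small g0 K0 e2.
  apply: filterS (HF X) => x /HX hx.
  rewrite normc_def ltcE /= Ime eqxx /=.
  have a : `|Ai - A x| < complex.Re e / 2 by rewrite distrC; exact: le_lt_trans (hA x) hx.
  have b : `|Bi - B x| < complex.Re e / 2 by rewrite distrC; exact: le_lt_trans (hB x) hx.
  rewrite -(ltr_pXn2r (n := 2)) ?nnegrE ?sqrtr_ge0 ?(ltW e1) // sqr_sqrtr ?addr_ge0 ?sqr_ge0 //.
  rewrite -(real_normK (num_real (Ai - A x))) -(real_normK (num_real (Bi - B x))).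
  have := normr_ge0 (Ai - A x); have := normr_ge0 (Bi - B x).
  move: (`|Ai - A x|) (`|Bi - B x|) a b => p q; nra.
split; apply: key => X.
  near=> x; have : X <= x by near: x; apply: nbhs_pinfty_ge; exact: num_real.
  by move=> h; apply: le_trans h (ler_norm _).
near=> x; have : x <= - X by near: x; apply: nbhs_ninfty_le; exact: num_real.
by move=> h; rewrite -normrN; apply: le_trans (ler_norm _); rewrite lerNr.
Unshelve. all: by end_near. Qed.

Lemma is_derive_dilation (q k : R) (f f' : R -> R) x : (forall y, der f y (f' y)) ->
  der (fun y => k * f (q * y)) x (k * q * f' (q * x)).
Proof.
move=> df; apply: is_derive_val (is_derive_cmulf k (is_derive_compf (df (q * x))
  (is_derive_cmulf q (is_derive_idf x)))).
by ring.
Qed.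

Lemma cderiveE (A B A1 B1 : R -> R) : (forall x, der A x (A1 x)) ->
  (forall x, der B x (B1 x)) ->
  (forall x, cderivable (fun x => A x +i* B x)%C x) /\
  cderive (fun x => A x +i* B x)%C = (fun x => A1 x +i* B1 x)%C.
Proof.
move=> dA dB; split=> [x|].
  by split; [have [] := is_derive_derive1 (dA x)|have [] := is_derive_derive1 (dB x)].
apply/funext => x; rewrite /cderive.
have [_ a] := is_derive_derive1 (dA x); have [_ b] := is_derive_derive1 (dB x).
by congr (_ +i* _)%C; [exact: a|exact: b].
Qed.

(** Undoing the scaling [a (x) = i eps^(-1/2) U (eps^(-1/2) x)]: the amplitude gains
    [eps^(-1/2)] on an interval of length [eps^(1/2)], so that the squared
    [L^2]-norm is at least of order [eps^(-1/2)]. *)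
Lemma solution_family (d zt ft c s : R) : 0 < d -> ft != 0 ->
  zt * c - c ^+ 3 + ft = 0 -> 0 < zt - 3 * c ^+ 2 -> s * s = 1 ->
  exists delta c1 : R, [/\ 0 < delta, 0 < c1 &
  forall eps kappa : R, 0 < eps < delta -> 0 < kappa < delta ->
  exists p : (R -> R[i]) * R[i],
  [/\ even_homoclinic_solution d (zt * eps^-1) (ft * eps `^ (- (3 / 2))) kappa p.1 p.2,
      limit_at_infinity p.1 p.2, 0 < s * complex.Im (p.1 0 - p.2) &
      c1 ^+ 2 / Num.sqrt eps <= L2norm (fun x => p.1 x - p.2) ^+ 2]].
Proof.
move=> d0 ft0 eqc al0 ss.
have [delta [c1 [delta0 c10 H]]] := profile_exists d0 ft0 eqc al0 ss.
exists delta, c1; split=> // eps kappa /andP[eps0 epsd] /andP[k0 kd].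
have [||Z [Z1 [Z2 [Zi [K [g [g0 HZ ZK ODE pos]]]]]]] := H eps kappa.
- by rewrite gtr0_norm // ltW.
- by rewrite gtr0_norm // ltW.
pose r := Num.sqrt eps; have r0 : 0 < r by rewrite sqrtr_gt0.
pose q := r^-1; have q0 : 0 < q by rewrite invr_gt0.
have r2 : eps = r ^+ 2 by rewrite sqr_sqrtr // ltW.
have qr : q * r = 1 by rewrite mulVf // gt_eqF.
have q2 : eps^-1 = q ^+ 2 by rewrite r2 exprVn.
have q3 : eps `^ (- (3 / 2)) = q ^+ 3 by rewrite powRN powR_three_halves ?ltW // exprVn.
have eq2 : eps * q ^+ 2 = 1 by rewrite -q2 divff // gt_eqF.
pose k i := if i then q else - q.
pose F i x := k i * Z i (q * x).
pose F1 i x := k i * q * Z1 i (q * x).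
pose F2 i x := k i * q * q * Z2 i (q * x).
pose Fi i := k i * Zi i.
have dF i x : der (F i) x (F1 i x).
  by have [dZ _ _ _ _] := HZ i; exact: is_derive_dilation.
have dF1 i x : der (F1 i) x (F2 i x).
  by have [_ dZ1 _ _ _] := HZ i; exact: is_derive_dilation.
have cF2 i : continuous (F2 i).
  have [_ _ cZ2 _ _] := HZ i; move=> x.
  apply: cvgM; first exact: cvg_cst.
  apply: (@continuous_comp _ _ _ (fun y => q * y) (Z2 i)); last exact: cZ2.
  exact: is_derive_cont (is_derive_cmulf q (is_derive_idf x)).
have K0 : 0 <= K.
  have [h _ _] := ZK true 0; have := le_trans (normr_ge0 _) h.
  by rewrite pmulr_lge0 ?expR_gt0.
pose K' := (q + q * q + q * q * q) * K.
have gq0 : 0 < g * q by rewrite mulr_gt0.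
have q20 : 0 < q * q by rewrite mulr_gt0.
have q30 : 0 < q * q * q by rewrite mulr_gt0.
have K'0 : 0 <= K' by rewrite mulr_ge0 // !addr_ge0 // ltW.
have absk i : `|k i| = q by rewrite /k; case: (i); rewrite ?normrN gtr0_norm.
have scale (t z x : R) : `|t| <= q + q * q + q * q * q ->
    `|z| <= K * expR (- g * `|q * x|) -> `|t * z| <= K' * expR (- (g * q) * `|x|).
  move=> ht hz; rewrite normrM /K' -[leRHS]mulrA; apply: ler_pM => //.
  apply: le_trans hz _; rewrite normrM (gtr0_norm q0).
  by have -> : - g * (q * `|x|) = - (g * q) * `|x| by ring.
have FK i x : [/\ `|F i x - Fi i| <= K' * expR (- (g * q) * `|x|),
    `|F1 i x| <= K' * expR (- (g * q) * `|x|) &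
    `|F2 i x| <= K' * expR (- (g * q) * `|x|)].
  have [h h1 h2] := ZK i (q * x); split.
  - rewrite /F /Fi -mulrBr; apply: scale => //.
    by rewrite absk -addrA lerDl addr_ge0 // ltW.
  - apply: scale => //; rewrite normrM absk (gtr0_norm q0) addrAC.
    by rewrite lerDr addr_ge0 // ltW.
  - apply: scale => //; rewrite !normrM absk (gtr0_norm q0).
    by rewrite lerDr addr_ge0 // ltW.
have [ca dca] := cderiveE (dF false) (dF true).
have [ca1 dca1] := cderiveE (dF1 false) (dF1 true).
have dFi i x : der (fun y => F i y - Fi i) x (F1 i x).
  by apply: is_derive_val (is_derive_addf (dF i x) (is_derive_cstf (- Fi i) x)); rewrite addr0.
have FKi i x : `|F i x - Fi i| <= K' * expR (- (g * q) * `|x|) by have [] := FK i x.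
exists ((fun x => F false x +i* F true x)%C, (Fi false +i* Fi true)%C); split=> /=.
- split.
  + move=> x; split; first exact: ca.
      by rewrite dca; exact: ca1.
    rewrite dca dca1 q2 q3.
    have Et := ODE true (q * x); have Ef := ODE false (q * x).
    rewrite /vector_field in Et Ef.
    set X := Z true (q * x) in Et Ef; set Y := Z false (q * x) in Et Ef.
    apply: complex_equation; rewrite /F /F2 /k -/X -/Y.
      transitivity (q ^+ 3 * (d * Z2 false (q * x) - (zt * Y - eps * X -
        (X ^+ 2 + Y ^+ 2) * Y - kappa * (X ^+ 2 + Y ^+ 2) * X)) +
        q * X * (1 - eps * q ^+ 2)); first by ring.
      by rewrite Ef eq2 !subrr !mulr0 addr0.
    transitivity (- q ^+ 3 * (d * Z2 true (q * x) - (zt * X + eps * Y -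
      (X ^+ 2 + Y ^+ 2) * X + kappa * (X ^+ 2 + Y ^+ 2) * Y + ft)) +
      q * Y * (1 - eps * q ^+ 2)); first by ring.
    by rewrite Et eq2 !subrr !mulr0 addr0.
  + rewrite dca /F1 mulr0.
    by have [_ _ _ -> _] := HZ true; have [_ _ _ -> _] := HZ false; rewrite !mulr0.
  + move=> x; rewrite /F mulrN.
    by have [_ _ _ _ ->] := HZ true; have [_ _ _ _ ->] := HZ false.
  + apply: (@H2_of_decay _ (fun x => F false x - Fi false) (F1 false) (F2 false)
      (fun x => F true x - Fi true) (F1 true) (F2 true) K' (g * q)) => //.
- exact: (limit_of_decay gq0 K'0 (FKi false) (FKi true)).
- have := pos 0 (lexx 0) ler01; rewrite /F /Fi /k mulr0 -mulrBr mulrCA => h.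
  by rewrite mulr_gt0 // (lt_le_trans c10).
- have cF i : continuous (fun x => F i x - Fi i).
    by move=> x; exact: is_derive_cont (dFi i x).
  have := @L2norm_ge R (fun x => F false x - Fi false) (fun x => F true x - Fi true)
    K' (g * q) r (q * c1) gq0 (cF false) (cF true) (FKi false) (FKi true) r0.
  have -> : (q * c1) ^+ 2 * r = c1 ^+ 2 / Num.sqrt eps.
    by rewrite -/r -/q; transitivity (c1 ^+ 2 * q * (q * r)); [ring|rewrite qr mulr1].
  apply => x x0 xr.
  have qx1 : q * x <= 1 by rewrite -qr ler_wpM2l // ltW.
  have h := pos (q * x) (mulr_ge0 (ltW q0) x0) qx1.
  apply: (@le_trans _ _ ((F true x - Fi true) ^+ 2)); last by rewrite lerDr sqr_ge0.
  have -> : (F true x - Fi true) ^+ 2 = (q * (s * (Z true (q * x) - Zi true))) ^+ 2.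
    rewrite /F /Fi /k; transitivity ((s * s) * (q * (Z true (q * x) - Zi true)) ^+ 2).
      by rewrite ss; ring.
    by ring.
  rewrite ler_pXn2r ?nnegrE; first by rewrite ler_wpM2l // ltW.
  + by [].
  + by rewrite mulr_ge0 // ltW.
  + by rewrite mulr_ge0 ?(ltW q0) // (le_trans (ltW c10)).
Qed.

End SolutionFamily.

Theorem theorem5 (R : realType) (d zt ft : R) (d_gt0 : 0 < d) (zt_gt0 : 0 < zt)
    (ft_neq0 : 0 < `|ft|)
    (ft_small : `|ft| < 2 * Num.sqrt 3 / 9 * zt `^ (3 / 2)) :
  exists eps0 kappa0 : R, [/\ 0 < eps0, 0 < kappa0 &
    exists (a : 'I_2 -> R -> R -> R -> R[i]) (ainf : 'I_2 -> R -> R -> R[i]),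
      (forall eps kappa : R, 0 < eps < eps0 -> 0 < kappa < kappa0 ->
        a ord0 eps kappa <> a ord_max eps kappa /\
        (forall j : 'I_2,
          even_homoclinic_solution d (zt * eps^-1) (ft * eps `^ (- (3 / 2)))
            kappa (a j eps kappa) (ainf j eps kappa) /\
          limit_at_infinity (a j eps kappa) (ainf j eps kappa))) /\
      (forall (j : 'I_2) (M : R), exists2 delta : R, 0 < delta &
        forall eps kappa : R, 0 < eps < eps0 -> eps < delta ->
          0 < kappa < kappa0 ->
          M < H2norm (fun x => a j eps kappa x - ainf j eps kappa))].
Proof.
have ft0 : ft != 0 by rewrite -normr_gt0.
have [c eqc al0] := constant_state zt_gt0 ft_small.
pose s (j : 'I_2) : R := if j == ord0 then 1 else -1.
have ss j : s j * s j = 1 by rewrite /s; case: ifP => _; rewrite ?mulrNN mulr1.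
have fam j := solution_family d_gt0 ft0 eqc al0 (ss j).
have [delta /choice[c1 Hfam]] := choice fam.
pose e0 := Num.min (delta ord0) (delta ord_max).
have e00 : 0 < e0.
  by rewrite lt_min; have [-> _ _] := Hfam ord0; have [-> _ _] := Hfam ord_max.
have e0j j : e0 <= delta j.
  rewrite ge_min; case: (unliftP ord_max j) => [i ->|->]; last by rewrite lexx orbT.
  by rewrite (ord1 i) (_ : lift ord_max ord0 = ord0) ?lexx //; exact: val_inj.
pose good j (ek : R * R) (p : (R -> R[i]) * R[i]) :=
  0 < ek.1 < e0 -> 0 < ek.2 < e0 ->
  [/\ even_homoclinic_solution d (zt * ek.1^-1) (ft * ek.1 `^ (- (3 / 2))) ek.2 p.1 p.2,
      limit_at_infinity p.1 p.2, 0 < s j * complex.Im (p.1 0 - p.2) &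
      c1 j ^+ 2 / Num.sqrt ek.1 <= L2norm (fun x => p.1 x - p.2) ^+ 2].
have ex_good j ek : exists p, good j ek p.
  have [[e1 k1]|ne] := pselect (0 < ek.1 < e0 /\ 0 < ek.2 < e0); last first.
    by exists (fun=> 0, 0) => e1 k1; case: ne.
  have [_ _ /(_ ek.1 ek.2)] := Hfam j; case=> [||p Hp].
  - by case/andP: e1 => -> /lt_le_trans->.
  - by case/andP: k1 => -> /lt_le_trans->.
  - by exists p.
have [P HP] := choice (fun jek : 'I_2 * (R * R) => ex_good jek.1 jek.2).
exists e0, e0; split=> //.
exists (fun j e k => (P (j, (e, k))).1), (fun j e k => (P (j, (e, k))).2); split.
  move=> e k he hk; have G j := HP (j, (e, k)) he hk; split; last first.
    by move=> j; have [] := G j.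
  (* The two families lie on opposite sides of the same limit at the origin. *)
  have [_ L0 s0 _] := G ord0; have [_ L1 s1 _] := G ord_max => E.
  have lim_eq : (P (ord0, (e, k))).2 = (P (ord_max, (e, k))).2.
    have [l0 _] := L0; have [l1 _] := L1; rewrite -E /= in l1.
    exact: (norm_cvg_unique l0 l1).
  rewrite -E /= -lim_eq /= in s1; rewrite /s /= in s0 s1.
  move: s0 s1; rewrite mul1r mulN1r oppr_gt0 => h0 h1.
  by have := lt_trans h0 h1; rewrite ltxx.
move=> j M; have [_ c10 _] := Hfam j.
pose m := c1 j ^+ 2 / (M ^+ 2 + 1).
have M10 : 0 < M ^+ 2 + 1 by rewrite ltr_wpDl // sqr_ge0.
have m0 : 0 < m by rewrite divr_gt0 // exprn_gt0.
(* [sqrt eps < m] means that the lower bound on the square of the norm exceeds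
   [M ^ 2 + 1]. *)
exists (m ^+ 2); first by rewrite exprn_gt0.
move=> e k he hem hk; have [_ _ _ hL] := HP (j, (e, k)) he hk.
have /andP[e1 _] := he.
have sqrt_e : Num.sqrt e < m.
  rewrite -(ltr_pXn2r (n := 2)) ?nnegrE ?sqrtr_ge0 ?(ltW m0) // sqr_sqrtr //.
  exact: ltW.
apply: lt_le_trans (H2norm_ge _).
set L := L2norm _ in hL *.
have L0 : 0 <= L by rewrite /L fine_ge0 // Lnorm_ge0.
have : M ^+ 2 < L ^+ 2.
  apply: lt_le_trans hL; apply: (@lt_trans _ _ (M ^+ 2 + 1)); first by rewrite ltrDl.
  by rewrite /= ltr_pdivlMr ?sqrtr_gt0 // mulrC -ltr_pdivlMr.
rewrite ltNge => /negP ML; rewrite ltNge; apply/negP => LM; apply: ML.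
by rewrite ler_pXn2r ?nnegrE // (le_trans L0 LM).
Qed.
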